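(* Let $(X,\mu,T)$ be an ergodic measure-theoretic dynamical system, that is, $X$ is a compact metric space, $T:X\to X$ is a homeomorphism, and $\mu$ is a $T$-invariant ergodic Borel probability measure on $X$. For each integer $n\geq 1$, let $(\mathcal{M}_n(X),(\hat{\psi}\circ\tau)_{*}(\mu^{(n)}),\widetilde{T})$ be the induced system on the space of averages of $n$ point masses, as defined in the context. Then the following assertions are equivalent: (i) $(X,\mu,T)$ has $\mu$-UPE; (ii) $(\mathcal{M}_n(X),(\hat{\psi}\circ\tau)_{*}(\mu^{(n)}),\widetilde{T})$ has $(\hat{\psi}\circ\tau)_{*}(\mu^{(n)})$-UPE for some $1\leq n<\infty$; (iii) $(\mathcal{M}_n(X),(\hat{\psi}\circ\tau)_{*}(\mu^{(n)}),\widetilde{T})$ has $(\hat{\psi}\circ\tau)_{*}(\mu^{(n)})$-UPE for every $1\leq n<\infty$.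
   Context: A topological dynamical system (TDS) is a pair $(X,T)$ with $X$ a compact metric space and $T:X\to X$ a homeomorphism. A measure-theoretic dynamical system (MDS) is a triple $(X,\mu,T)$ where $(X,T)$ is a TDS and $\mu$ is a $T$-invariant Borel probability measure on $X$. Space of measures. $\mathcal{M}(X)$ is the space of all Borel probability measures on $X$ with the Prohorov metric $d_P(\mu,\nu)=\inf\{\delta>0:\mu(A)\leq\nu(A^\delta)+\delta\text{ for all Borel }A\subset X\}$, where $A^\delta$ denotes the $\delta$-neighborhood of $A$; this metric induces the weak*-topology and makes $\mathcal{M}(X)$ a compact metric space. The induced homeomorphism $\widetilde{T}:\mathcal{M}(X)\to\mathcal{M}(X)$ is $(\widetilde{T}(\nu))(A)=\nu(T^{-1}(A))$ for Borel $A\subset X$. For $n\geq 1$, $$\mathcal{M}_n(X)=\Big\{\frac1n\sum_{i=1}^n\delta_{x_i}: x_1,\dots,x_n\in X \text{ not necessarily distinct}\Big\}\subset\mathcal{M}(X),$$ where $\delta_x$ is the unit mass at $x$. It carries the subspace topology and is $\widetilde{T}$-invariant; the restriction of $\widetilde{T}$ to $\mathcal{M}_n(X)$ is still denoted $\widetilde{T}$. Measure on $\mathcal{M}_n(X)$. Let $X^{(n)}=X\times\dots\times X$ ($n$ factors) and $\mu^{(n)}=\mu\times\dots\times\mu$ the product measure. Let $S_n$ be the group of permutations of $n$ elements acting on $X^{(n)}$ by permuting coordinates, $\hat{X}^{(n)}=X^{(n)}/S_n$, $\tau:X^{(n)}\to\hat{X}^{(n)}$ the quotient map, and write $\langle x_1,\dots,x_n\rangle=\tau(x_1,\dots,x_n)$.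 Let $\hat{\psi}:\hat{X}^{(n)}\to\mathcal{M}_n(X)$, $\hat{\psi}(\langle x_1,\dots,x_n\rangle)=\frac1n\sum_{l=1}^n\delta_{x_l}$. Then $(\hat{\psi}\circ\tau)_{*}(\mu^{(n)})=\mu^{(n)}\circ(\hat\psi\circ\tau)^{-1}$ is the push-forward measure on $\mathcal{M}_n(X)$, i.e. the push-forward of $\mu^{(n)}$ under $(x_1,\dots,x_n)\mapsto\frac1n\sum_{l=1}^n\delta_{x_l}$; it is $\widetilde{T}$-invariant. Entropy. For an MDS $(Y,\nu,S)$ and a finite measurable partition $\mathcal{P}$ of $Y$, $H_\nu(\mathcal{P})=-\sum_{P\in\mathcal{P}}\nu(P)\log_2\nu(P)$ and $h_\nu(S,\mathcal{P})=\lim_{n\to\infty}\frac1n H_\nu(\mathcal{P}\vee S^{-1}\mathcal{P}\vee\dots\vee S^{-(n-1)}\mathcal{P})$. UPE. For an MDS $(Y,\nu,S)$, a pair of distinct points $y,y'\in Y$ is a $\nu$-entropy pair if $h_\nu(S,\mathcal{P})>0$ for every measurable partition $\mathcal{P}=\{F,F^c\}$ of $Y$ such that $F$ contains a neighborhood of $y$ and $F^c$ contains a neighborhood of $y'$. The MDS $(Y,\nu,S)$ has $\nu$-UPE (measure-theoretic uniformly positive entropy) if every pair of distinct points of $Y$ is a $\nu$-entropy pair; equivalently, if $h_\nu(S,\mathcal{P})>0$ for every two-set Borel partition $\mathcal{P}=\{P_0,P_1\}$ of $Y$ with $\operatorname{int}P_0\neq\varnothing$ and $\operatorname{int}P_1\neq\varnothing$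 (a replete partition). *)

(* Defs.v *)
From HB Require Import structures.
From mathcomp Require Import all_boot all_order all_algebra.
From mathcomp Require Import all_classical all_reals all_analysis.
From mathcomp Require Import ring lra.

Set Implicit Arguments.
Unset Strict Implicit.
Unset Printing Implicit Defensive.

Import Order.TTheory GRing.Theory Num.Theory.
Import numFieldNormedType.Exports.

Local Open Scope classical_set_scope.
Local Open Scope ring_scope.

HB.mixin Record isBorel d T & Topological T & Measurable d T := {
  measurable_borelE : @measurable d T = <<s @open T >>
}.

(* Measurable types are pointed in the library; this is harmless here, as a
   space carrying a probability measure is nonempty. *)
#[short(type="borelMetricType")]
HB.structure Definition BorelMetric d (R : numDomainType) :=
  {T of Metric R T & Measurable d T & @isBorel d T}.

Section topological_dynamics.
Context {T : topologicalType}.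

Definition homeomorphism (f : T -> T) :=
  continuous f /\ exists g : T -> T, [/\ continuous g, cancel f g & cancel g f].

End topological_dynamics.

Section measure_dynamics.
Context {d} {T : measurableType d} {R : realType}.

Definition invariant_measure (mu : probability T R) (f : T -> T) :=
  forall A, measurable A -> mu (f @^-1` A) = mu A.

Definition ergodic (mu : probability T R) (f : T -> T) :=
  forall A, measurable A -> f @^-1` A = A -> mu A = 0%E \/ mu A = 1%E.

End measure_dynamics.

(* As for the library integral, nu is a bare set function; only its values on
   measurable sets are used. *)
Section entropy.
Context {R : realType} {T : Type}.
Implicit Types (nu : set T -> \bar R) (f : T -> T).

Definition log2 (x : R) : R := ln x / ln 2.

(* Finite partitions are families of sets indexed by a finite type; the value
   at an empty cell is 0 because ln 0 = 0. *)
Definition partition_entropy nu (I : finType) (P : I -> set T) : R :=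
  - \sum_(i : I) fine (nu (P i)) * log2 (fine (nu (P i))).

(* P \/ f^-1 P \/ ... \/ f^-(n-1) P, with cells indexed by itineraries. *)
Definition refined_partition f (I : finType) (P : I -> set T) (n : nat)
    (w : {ffun 'I_n -> I}) : set T :=
  \bigcap_(i : 'I_n) (iter i f @^-1` P (w i)).

Definition dynamical_entropy nu f (I : finType) (P : I -> set T) : R :=
  limn (fun n => n%:R^-1 * partition_entropy nu (@refined_partition f I P n)).

Definition two_set_partition (F : set T) (b : bool) : set T :=
  if b then F else ~` F.

End entropy.

Section uniformly_positive_entropy.
Context {d} {R : realType} {Y : borelMetricType d R}.

Definition entropy_pair (nu : set Y -> \bar R) (S : Y -> Y) (y y' : Y) :=
  y <> y' /\
  forall F : set Y, measurable F -> nbhs y F -> nbhs y' (~` F) ->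
    0 < dynamical_entropy nu S (two_set_partition F).

Definition UPE (nu : set Y -> \bar R) (S : Y -> Y) :=
  forall y y' : Y, y <> y' -> entropy_pair nu S y y'.

End uniformly_positive_entropy.

Section tuple_product_measure.
Context {d} {T : measurableType d} {R : realType}.

Definition pair_cons (n : nat) (p : T * n.-tuple T) : n.+1.-tuple T :=
  [tuple of p.1 :: p.2].

Lemma measurable_pair_cons n : measurable_fun setT (@pair_cons n).
Proof. by apply: measurable_cons. Qed.

HB.instance Definition _ n :=
  isMeasurableFun.Build _ _ _ _ (@pair_cons n) (@measurable_pair_cons n).

Fixpoint tuple_product (mu : probability T R) (n : nat) :
    probability (n.-tuple T) R :=
  if n is k.+1 then distribution (mu \x tuple_product mu k)%E (@pair_cons k)
  else \d_[tuple].

End tuple_product_measure.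

Section prohorov_metric.
Context {d} {R : realType} {X : borelMetricType d R}.
Implicit Types (mu nu : probability X R) (A : set X).

Definition thickening A (e : R) : set X :=
  [set y | exists2 x, A x & mdist x y < e].

Definition prohorov_bound mu nu : set R :=
  [set e | 0 < e /\
    forall A, measurable A -> (mu A <= nu (thickening A e) + e%:E)%E].

Definition prohorov_dist mu nu : R := inf (prohorov_bound mu nu).

Lemma open_measurable_borel A : open A -> measurable A.
Proof. by rewrite measurable_borelE => oA; exact: sub_sigma_algebra. Qed.

Lemma closed_measurable_borel A : closed A -> measurable A.
Proof.
move=> cA; rewrite -(setCK A); apply: measurableC.
by apply: open_measurable_borel; exact: closed_openC.
Qed.

Lemma open_thickening A e : open (thickening A e).
Proof.
rewrite openE => y [x Ax xy]; apply/nbhs_ballP.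
exists (e - mdist x y) => /=; first by rewrite subr_gt0.
move=> z; rewrite ballEmdist /= => yz; exists x => //.
by rewrite (le_lt_trans (metric_triangle _ y _))// -ltrBrDl.
Qed.

Lemma measurable_thickening A e : measurable (thickening A e).
Proof. by apply: open_measurable_borel; exact: open_thickening. Qed.

Lemma sub_thickening A e : 0 < e -> A `<=` thickening A e.
Proof. by move=> e0 x Ax; exists x; rewrite ?mdistxx. Qed.

Lemma prohorov_bound_refl mu e : 0 < e -> prohorov_bound mu mu e.
Proof.
move=> e0; split=> // A mA; rewrite -[leLHS]adde0; apply: leeD; last by rewrite lee_fin ltW.
by apply: le_measure; rewrite ?inE//;
  [exact: measurable_thickening|exact: sub_thickening].
Qed.

Lemma prohorov_bound1 mu nu : prohorov_bound mu nu 1.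
Proof.
split=> // A mA; apply: (le_trans (probability_le1 _ mA)).
by rewrite leeDr // measure_ge0.
Qed.

Lemma prohorov_bound_le mu nu e1 e2 :
  e1 <= e2 -> prohorov_bound mu nu e1 -> prohorov_bound mu nu e2.
Proof.
move=> e12 [e10 h]; split; first exact: lt_le_trans e12.
move=> A mA; apply: (le_trans (h _ mA)); apply: leeD; last by rewrite lee_fin.
apply: le_measure; rewrite ?inE; [exact: measurable_thickening..|].
by move=> y [x Ax xy]; exists x => //; exact: lt_le_trans e12.
Qed.

Lemma prohorov_bound_sym mu nu e :
  prohorov_bound mu nu e -> prohorov_bound nu mu e.
Proof.
move=> [e0 h]; split=> // B mB.
have mC := measurableC (measurable_thickening B e).
have sub : thickening (~` thickening B e) e `<=` ~` B.
  by move=> y [x Bx xy] By; apply: Bx; exists y => //; rewrite metric_sym.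
have mT := measurable_thickening B e.
have le1 : (nu (thickening (~` thickening B e) e) <= nu (~` B))%E.
  apply: le_measure => //; rewrite inE; last exact: measurableC.
  exact: measurable_thickening.
have := le_trans (h _ mC) (leeD le1 (lexx _)).
rewrite (probability_setC _ mT) (probability_setC _ mB).
have -> : nu B = (fine (nu B))%:E by rewrite fineK// fin_num_measure.
have -> : mu (thickening B e) = (fine (mu (thickening B e)))%:E.
  by rewrite fineK// fin_num_measure.
by rewrite -!EFinB -!EFinD !lee_fin; lra.
Qed.

Lemma prohorov_bound_triangle mu nu la e1 e2 : prohorov_bound mu nu e1 ->
  prohorov_bound nu la e2 -> prohorov_bound mu la (e1 + e2).
Proof.
move=> [e10 h1] [e20 h2]; split; first exact: addr_gt0.
move=> A mA; apply: (le_trans (h1 _ mA)).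
rewrite EFinD [(e1%:E + _)%E]addeC addeA; apply: leeD => //.
apply: (le_trans (h2 _ (measurable_thickening A e1))); apply: leeD => //.
apply: le_measure; rewrite ?inE; [exact: measurable_thickening..|].
move=> z [y [x Ax xy] yz]; exists x => //.
by rewrite (le_lt_trans (metric_triangle _ y _))// ltrD.
Qed.

Lemma has_inf_prohorov_bound mu nu : has_inf (prohorov_bound mu nu).
Proof.
split; first by exists 1; exact: prohorov_bound1.
by exists 0 => e [/ltW].
Qed.

Lemma prohorov_dist_lt mu nu e :
  prohorov_dist mu nu < e -> prohorov_bound mu nu e.
Proof.
move=> /(inf_lt (has_inf_prohorov_bound mu nu).1)[r Pr /ltW re].
exact: prohorov_bound_le Pr.
Qed.

Lemma prohorov_dist_le mu nu e :
  prohorov_bound mu nu e -> prohorov_dist mu nu <= e.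
Proof. by move=> Pe; apply: ge_inf Pe; have [] := has_inf_prohorov_bound mu nu. Qed.

Lemma prohorov_distxx mu : prohorov_dist mu mu = 0.
Proof.
apply/eqP; rewrite eq_le; apply/andP; split.
  apply/ler_addgt0Pl => e e0; rewrite addr0.
  by apply: prohorov_dist_le; exact: prohorov_bound_refl.
apply: lb_le_inf; first by exists 1; exact: prohorov_bound1.
by move=> e [/ltW].
Qed.

Lemma prohorov_dist_sym mu nu : prohorov_dist mu nu = prohorov_dist nu mu.
Proof.
congr inf; apply/seteqP; split=> e; exact: prohorov_bound_sym.
Qed.

Lemma prohorov_dist_triangle nu mu la :
  prohorov_dist mu la <= prohorov_dist mu nu + prohorov_dist nu la.
Proof.
apply/ler_addgt0Pl => e e0.
have e20 : 0 < e / 2 by rewrite divr_gt0.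
have /prohorov_dist_lt h1 : prohorov_dist mu nu < prohorov_dist mu nu + e / 2.
  by rewrite ltrDl.
have /prohorov_dist_lt h2 : prohorov_dist nu la < prohorov_dist nu la + e / 2.
  by rewrite ltrDl.
have := prohorov_dist_le (prohorov_bound_triangle h1 h2).
by lra.
Qed.

End prohorov_metric.

Section average_of_point_masses.
Context {d} {R : realType} {X : borelMetricType d R}.

Definition average (n : nat) (x : n.-tuple X) (A : set X) : \bar R :=
  ((n%:R^-1)%:E * \sum_(i < n) \d_(tnth x i) A)%E.

Lemma averageE n (x : n.+1.-tuple X) :
  average x = mscale (n.+1%:R^-1 : R)%:nng
    (msum (fun i => \d_(nth point x i)) n.+1).
Proof.
apply/funext => A; rewrite /average /mscale /msum /=; congr (_ * _)%E.
by apply: eq_bigr => i _; rewrite (tnth_nth point).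
Qed.

Section average_is_probability.
Variables (n : nat) (x : n.+1.-tuple X).

Let average0 : average x set0 = 0%E.
Proof. by rewrite averageE measure0. Qed.

Let average_ge0 A : (0 <= average x A)%E.
Proof. by rewrite averageE measure_ge0. Qed.

Let average_sigma_additive : semi_sigma_additive (average x).
Proof. by rewrite averageE; exact: measure_semi_sigma_additive. Qed.

HB.instance Definition _ := isMeasure.Build _ _ _ (average x)
  average0 average_ge0 average_sigma_additive.

Let averageT : average x setT = 1%E.
Proof.
rewrite /average (eq_bigr (fun=> 1%:E)) => [|i _]; last by rewrite diracT.
by rewrite sumEFin sumr_const card_ord -EFinM mulVf// pnatr_eq0.
Qed.

HB.instance Definition _ :=
  Measure_isProbability.Build _ _ _ (average x) averageT.

End average_is_probability.

(* Equality is required on all sets, not only Borel ones: point masses are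
   defined on every set, and elements of probability X R are compared as
   functions on all sets. *)
Definition average_space (n : nat) : Type :=
  {nu : probability X R | exists x : n.-tuple X, forall A, nu A = average x A}.

Lemma eq_probability (mu nu : probability X R) :
  mu = nu :> (set X -> \bar R) -> mu = nu.
Proof.
case: mu nu => [m Pm] [m' Pm'] /= mm'; case: _ / mm' in Pm' *.
move: Pm Pm' => [[a0 a1] [a2] [a3] [a4] [a5] [a6] [a7]].
move=> [[b0 b1] [b2] [b3] [b4] [b5] [b6] [b7]].
rewrite (Prop_irrelevance b0 a0) in b2 *.
rewrite (Prop_irrelevance b1 a1) in b2 *.
rewrite (Prop_irrelevance b2 a2) (Prop_irrelevance b3 a3) (Prop_irrelevance b4 a4).
rewrite (Prop_irrelevance b5 a5) (Prop_irrelevance b6 a6).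
by rewrite (Prop_irrelevance b7 a7).
Qed.

Lemma average_space_inj n (a b : average_space n) :
  (forall A, sval a A = sval b A) -> a = b.
Proof.
case: a b => [a Pa] [b Pb] /= ab; apply: eq_exist.
by apply: eq_probability; exact/funext.
Qed.

HB.instance Definition _ n := gen_eqMixin (average_space n).
HB.instance Definition _ n := gen_choiceMixin (average_space n).

Lemma average_separation n (x y : n.-tuple X) : exists2 e : R, 0 < e &
  forall i j, mdist (tnth x i) (tnth y j) < e -> tnth x i = tnth y j.
Proof.
pose e := \big[Order.min/1]_(p : 'I_n * 'I_n | tnth x p.1 != tnth y p.2)
  mdist (tnth x p.1) (tnth y p.2) : R.
exists e; first by apply: lt_bigmin => // p; rewrite mdist_gt0.
move=> i j xye; apply/eqP; apply: contraTT xye => xy.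
by rewrite -leNgt; apply: (bigmin_le_cond _ (j := (i, j))).
Qed.

Lemma prohorov_average_le n (mu nu : probability X R) (x y : n.-tuple X) :
    (forall A, mu A = average x A) -> (forall A, nu A = average y A) ->
    (forall e, 0 < e -> prohorov_bound mu nu e) ->
  forall A, (mu A <= nu A)%E.
Proof.
move=> mux nuy h A.
have [e0 e00 sep] := average_separation x y.
pose B := A `&` [set tnth x i | i in [set: 'I_n]].
have mB : measurable B.
  apply: closed_measurable_borel.
  have /hausdorff_accessible/accessible_finite_set_closed := @metric_hausdorff R X.
  apply; apply: finite_setIr; apply: finite_image; exact: finite_finset.
have muB : mu A = mu B.
  rewrite !mux /average; congr (_ * _)%E; apply: eq_bigr => i _.
  rewrite !diracE; congr (_ %:R)%:E; congr nat_of_bool.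
  apply/idP/idP; rewrite !inE; last by case.
  by move=> Ax; split=> //; exists i.
rewrite muB; apply/lee_addgt0Pr => e e_gt0.
have d0 : 0 < Num.min e e0 by rewrite lt_min e_gt0.
apply: (le_trans ((h _ d0).2 _ mB)); apply: leeD; last first.
  by rewrite lee_fin ge_min lexx.
rewrite !nuy /average; apply: lee_wpmul2l; first by rewrite lee_fin invr_ge0.
apply: lee_sum => j _; rewrite !diracE lee_fin ler_nat.
case: (boolP (tnth y j \in thickening _ _)) => //.
rewrite inE => -[z [Az [i _ iz]] zy]; rewrite mem_set//.
have <- : tnth x i = tnth y j; last by rewrite iz.
apply: sep; rewrite iz; apply: lt_le_trans zy _.
by rewrite ge_min lexx orbT.
Qed.

Definition average_dist n (a b : average_space n) : R :=
  prohorov_dist (sval a) (sval b).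

Lemma average_distxx n (a : average_space n) : average_dist a a = 0.
Proof. exact: prohorov_distxx. Qed.

Lemma average_dist_sym n (a b : average_space n) :
  average_dist a b = average_dist b a.
Proof. exact: prohorov_dist_sym. Qed.

Lemma average_dist_triangle n (b a c : average_space n) :
  average_dist a c <= average_dist a b + average_dist b c.
Proof. exact: prohorov_dist_triangle. Qed.

Lemma average_dist_positivity n (a b : average_space n) :
  average_dist a b = 0 -> a = b.
Proof.
move=> ab0; have ba0 : average_dist b a = 0 by rewrite average_dist_sym.
apply: average_space_inj => A; apply/eqP; rewrite eq_le; apply/andP; split.
- have [x xa] := svalP a; have [y yb] := svalP b.
  apply: (prohorov_average_le xa yb) => e e0; apply: prohorov_dist_lt.
  by rewrite [prohorov_dist _ _]ab0.
- have [x xa] := svalP a; have [y yb] := svalP b.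
  apply: (prohorov_average_le yb xa) => e e0; apply: prohorov_dist_lt.
  by rewrite [prohorov_dist _ _]ba0.
Qed.

(* The subspace topology of the Prohorov topology. *)
HB.instance Definition _ n := isMetric.Build R (average_space n)
  (@average_distxx n) (@average_dist_positivity n) (@average_dist_sym n)
  (@average_dist_triangle n).

(* From here on the parameter n stands for tuples of length n + 1, so that the
   average is a probability measure. The map is constant on orbits of
   permutations of coordinates: it is the composite of the quotient map onto
   unordered tuples with the map sending an unordered tuple to its average. *)
Definition average_map n (x : n.+1.-tuple X) : average_space n.+1 :=
  exist _ (average x : probability X R) (ex_intro _ x (fun=> erefl)).

HB.instance Definition _ n :=
  isPointed.Build (average_space n.+1) (average_map (nseq_tuple n.+1 point)).

HB.instance Definition _ n := Measurable.copy (average_space n.+1)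
  (g_sigma_algebraType (@open (average_space n.+1))).

HB.instance Definition _ n :=
  @isBorel.Build _ (average_space n.+1) erefl.

Definition average_measure (mu : probability X R) n :
    set (average_space n.+1) -> \bar R :=
  pushforward (tuple_product mu n.+1) (@average_map n).

End average_of_point_masses.

Section induced_map.
Context {d} {R : realType} {X : borelMetricType d R}.
Variables (T : X -> X) (hT : homeomorphism T).

Lemma homeomorphism_measurable : measurable_fun setT T.
Proof.
have [cT _] := hT; apply: (measurability (@open X)).
  exact: measurable_borelE.
move=> _ [U oU <-]; rewrite setTI; apply: open_measurable_borel.
by move/continuousP : cT; exact.
Qed.

Definition homeomorphism_mfun : {mfun X >-> X} :=
  HB.pack T (isMeasurableFun.Build _ _ _ _ T homeomorphism_measurable).

Definition induced_measure (nu : probability X R) : probability X R :=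
  distribution nu homeomorphism_mfun.

Lemma induced_average n (nu : average_space n) :
  exists x : n.-tuple X, forall A, induced_measure (sval nu) A = average x A.
Proof.
have [x xnu] := svalP nu; exists [tuple of map T x] => A.
rewrite /induced_measure/= /distribution /pushforward xnu /average.
congr (_ * _)%E; apply: eq_bigr => i _; rewrite tnth_map !diracE.
by congr (_ %:R)%:E; congr nat_of_bool; apply/idP/idP; rewrite !inE.
Qed.

Definition induced_map n (nu : average_space n) : average_space n :=
  exist _ (induced_measure (sval nu)) (induced_average nu).

End induced_map.

Arguments average_measure {d R X} mu n.
Arguments induced_map {d R X T} hT n nu.

(* Main.v *)
(* A set of zero entropy for a product system has almost all of its sections of
   zero entropy: if the sections over a set B of positive measure are close to
   a fixed set D, then along the orbit of a base point each visit to B must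
   contribute about as much entropy as D, while the total, averaged over the
   base points, grows sublinearly. Say that A and B are inseparable when no set
   of zero entropy contains A and misses B, up to null sets. Applying the
   section statement to both coordinates, inseparability of A1, B1 and of A2, B2
   implies that of A1 x A2, B1 x B2. Under UPE any two neighbourhoods in X are
   inseparable, hence so are any two boxes in the power X^n, and two sets in the
   space of averages with nonempty interior pull back to sets containing boxes.
   Conversely, if F has zero entropy in X then so has F^n in X^n, which is the
   inverse image of the set of averages charging only F. *)

Require Import Defs.
From HB Require Import structures.
From mathcomp Require Import all_boot all_order all_algebra.
From mathcomp Require Import all_classical all_reals all_analysis.
From mathcomp Require Import measurable_realfun.
From mathcomp Require Import ring lra.

Set Implicit Arguments.
Unset Strict Implicit.
Unset Printing Implicit Defensive.

Import Order.TTheory GRing.Theory Num.Theory.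
Import numFieldNormedType.Exports.

Local Open Scope classical_set_scope.
Local Open Scope ring_scope.

(** * Entropy of finite families of sets *)

(** The sets of zero entropy form, up to null sets, the Pinsker sigma-algebra. It is never built: it
    suffices that these sets are stable under intersections and under limits in measure, so that
    every measurable set has a smallest cover of zero entropy, its hull. The obstacle in the section
    statement is that the fibres met along an orbit change with time, while entropy is controlled
    only for preimages of one set. Replacing nearby fibres by a fixed [D] repairs this, because
    positive entropy of [D] bounds every entropy increment of [D] below by one constant: preimages
    of [D] at any selection of times then have entropy at least proportional to their number,
    however irregular the visits are. Only the mean number of visits is needed, and invariance gives
    it. Countably many sets [D] approximate all fibres, which keeps the exceptional base points in a
    null set. Sections and hulls are known only up to null sets, whereas entropy pairs ask for true
    neighbourhoods; a correction on a null set bridges the two. Distinct averages may also share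
    coordinates, so boxes with a common centre in some coordinate must be handled. *)

Section entropy_function.
Context {R : realType}.
Implicit Types x y p r c s e : R.

Definition entropy_term x : R := - (x * ln x).

Lemma entropy_term0 : entropy_term 0 = 0. Proof. by rewrite /entropy_term mul0r
  oppr0. Qed.

Lemma entropy_term1 : entropy_term 1 = 0. Proof. by rewrite /entropy_term ln1
  mulr0 oppr0. Qed.

Lemma entropy_term_ge0 x : 0 <= x <= 1 -> 0 <= entropy_term x.
Proof. by move=> /andP[x0 x1]; rewrite /entropy_term oppr_ge0 mulr_ge0_le0 //
  ln_le0. Qed.

Lemma ln_le_subr1 x : 0 < x -> ln x <= x - 1.
Proof.
move=> x0; have -> : ln x = ln (1 + (x - 1)) by congr ln; ring.
by apply: le_ln1Dx; lra.
Qed.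

Lemma entropy_termD_le x y : 0 <= x -> 0 <= y ->
  entropy_term (x + y) <= entropy_term x + entropy_term y.
Proof.
rewrite le_eqVlt => /predU1P[<-|x0]; first by rewrite entropy_term0 !add0r.
rewrite le_eqVlt => /predU1P[<-|y0]; first by rewrite entropy_term0 !addr0.
have h1 : ln x <= ln (x + y) by rewrite ler_ln ?posrE; lra.
have h2 : ln y <= ln (x + y) by rewrite ler_ln ?posrE; lra.
have := ler_wpM2l (ltW x0) h1; have := ler_wpM2l (ltW y0) h2.
by rewrite /entropy_term; lra.
Qed.

(** Concavity: the right-hand side is the tangent of [entropy_term] at [s]. *)
Lemma entropy_term_le_tangent x s : 0 <= x -> 0 < s -> entropy_term x <= x * -
  ln s + s - x.
Proof.
rewrite le_eqVlt => /predU1P[<-|x0] s0; first by rewrite entropy_term0 mul0r;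
  lra.
have := ln_le_subr1 (divr_gt0 s0 x0); rewrite ln_div ?posrE// => h.
have := ler_wpM2l (ltW x0) h.
have -> : x * (s / x - 1) = s - x by field; rewrite gt_eqF.
by rewrite /entropy_term; lra.
Qed.

(** This is [ln u <= u - 1] at [u = r c / (p s)], for a cell [p] with row sum [r], column sum [c]
    and total [s]. Over the four cells of a table both [p] and [r c / s] sum to [s], so the lower
    bounds cancel. *)
Let information_term p r c s : 0 <= p -> p <= r -> p <= c -> r <= s ->
  p - r * c / s <= p * (ln p + ln s - ln r - ln c).
Proof.
rewrite le_eqVlt => /predU1P[<-|p0] pr pc rs.
  by rewrite mul0r sub0r oppr_le0 divr_ge0 ?mulr_ge0//; lra.
have [r0 c0 s0] : [/\ 0 < r, 0 < c & 0 < s] by split; lra.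
have := ln_le_subr1 (divr_gt0 (mulr_gt0 r0 c0) (mulr_gt0 p0 s0)).
rewrite ln_div ?posrE ?mulr_gt0// !lnM ?posrE// => h.
have := ler_wpM2l (ltW p0) h.
have -> : p * (r * c / (p * s) - 1) = r * c / s - p.
  by field; rewrite !gt_eqF.
lra.
Qed.

(* Nonnegativity of the mutual information of a 2 x 2 table. *)
Lemma entropy_term_superadditive x1 y1 x2 y2 :
  0 <= x1 -> 0 <= y1 -> 0 <= x2 -> 0 <= y2 ->
  (entropy_term x1 + entropy_term y1 - entropy_term (x1 + y1)) +
  (entropy_term x2 + entropy_term y2 - entropy_term (x2 + y2)) <=
  entropy_term (x1 + x2) + entropy_term (y1 + y2) -
  entropy_term ((x1 + x2) + (y1 + y2)).
Proof.
move=> x10 y10 x20 y20.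
set s := (x1 + x2) + (y1 + y2).
have [s0|s0] := leP s 0.
  have [+ [+ [+ +]]] : x1 = 0 /\ x2 = 0 /\ y1 = 0 /\ y2 = 0.
    by move: s0; rewrite /s => s0; do !split; lra.
  by rewrite /s; (do 4!move=> ->); rewrite !addr0 entropy_term0; lra.
have h1 := @information_term x1 (x1 + y1) (x1 + x2) s x10.
have h2 := @information_term y1 (x1 + y1) (y1 + y2) s y10.
have h3 := @information_term x2 (x2 + y2) (x1 + x2) s x20.
have h4 := @information_term y2 (x2 + y2) (y1 + y2) s y20.
have e0 : (x1 + y1) * (x1 + x2) / s + (x1 + y1) * (y1 + y2) / s +
    (x2 + y2) * (x1 + x2) / s + (x2 + y2) * (y1 + y2) / s = s.
  by rewrite -!mulrDl -!mulrDr; apply: (canLR (mulfK _));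
    [rewrite gt_eqF|rewrite /s; ring].
have {}h1 := h1 ltac:(lra) ltac:(lra) ltac:(rewrite /s; lra).
have {}h2 := h2 ltac:(lra) ltac:(lra) ltac:(rewrite /s; lra).
have {}h3 := h3 ltac:(lra) ltac:(lra) ltac:(rewrite /s; lra).
have {}h4 := h4 ltac:(lra) ltac:(lra) ltac:(rewrite /s; lra).
rewrite /entropy_term -/s; move: e0 h1 h2 h3 h4; rewrite /s; lra.
Qed.

(** With [u] the square root of [x], the left side is [- 2 u^2 ln u], and [- ln u <= 1 / u]. This
    gives an explicit rate of convergence at 0. *)
Lemma entropy_term_le_sqrt x : 0 <= x -> entropy_term x <= 2 * Num.sqrt x.
Proof.
rewrite le_eqVlt => /predU1P[<-|x0]; first by rewrite entropy_term0 mulr_ge0//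
  sqrtr_ge0.
have s0 : 0 < Num.sqrt x by rewrite sqrtr_gt0.
have xE : x = Num.sqrt x * Num.sqrt x by rewrite -expr2 sqr_sqrtr// ltW.
set u := Num.sqrt x in s0 xE *.
have h : - ln u <= u^-1 by rewrite -lnV ?posrE//; apply/ltW/ln_sublinear;
  rewrite invr_gt0.
have := ler_wpM2l (ltW (mulr_gt0 s0 s0)) h.
have -> : u * u * u^-1 = u by rewrite mulfK ?gt_eqF.
by rewrite /entropy_term xE lnM ?posrE//; lra.
Qed.

Lemma entropy_term_compl_le x : 0 <= x < 1 -> entropy_term (1 - x) <= x.
Proof.
move=> /andP[x0 x1]; have p : 0 < 1 - x by lra.
have := entropy_term_le_tangent (ltW p) (@ltr01 R); rewrite ln1; lra.
Qed.

Lemma binary_entropy_small e : 0 < e ->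
  exists2 r, 0 < r & forall x, 0 <= x < r -> entropy_term x + entropy_term (1 -
    x) <= e.
Proof.
(* For [x < u^2] the first term is at most [2 u <= e / 2] and the second at most
   [x <= u / 2 <= e / 8]; the cap at one half also keeps [x] below 1. *)
move=> e0; pose u := Num.min (e / 4) (2^-1).
have u0 : 0 < u by rewrite lt_min; apply/andP; split; lra.
have u1 : u <= e / 4 by rewrite ge_min lexx.
have u2 : u <= 2^-1 by rewrite ge_min lexx orbT.
exists (u ^+ 2); first by rewrite exprn_gt0.
move=> x /andP[x0 xu].
have su : Num.sqrt x <= u.
  rewrite (_ : u = Num.sqrt (u ^+ 2)); last by rewrite sqrtr_sqr ger0_norm ?ltW.
  by apply: ler_wsqrtr; exact: ltW.
have h1 := entropy_term_le_sqrt x0.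
have uu : u ^+ 2 <= u * 2^-1 by rewrite expr2 ler_wpM2l // ltW.
have h2 : entropy_term (1 - x) <= x by apply: entropy_term_compl_le; lra.
lra.
Qed.

End entropy_function.

(* The partition generated by the members of [s] is traversed one set at a
   time, so that joins are concatenations; [m] need only be a set function. *)
Fixpoint cell_entropy (R : realType) (T : Type) (m : set T -> R) (A : set T)
    (s : seq (set T)) : R :=
  if s is E :: s' then cell_entropy m (A `&` E) s' + cell_entropy m (A `\` E) s'
  else entropy_term (m A).

Definition set_entropy (R : realType) (T : Type) (m : set T -> R) :=
  cell_entropy m setT.

Fixpoint all_measurable d (T : measurableType d) (s : seq (set T)) : Prop :=
  if s is E :: s' then measurable E /\ all_measurable s' else True.

Section all_measurable_lemmas.
Context {d} {T : measurableType d}.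
Implicit Types (s t : seq (set T)) (E F : set T).

Lemma all_measurable_cat s t :
  all_measurable s -> all_measurable t -> all_measurable (s ++ t).
Proof. by elim: s => //= E s IH [mE ms] mt; split=> //; exact: IH. Qed.

Lemma all_measurable_map (J : Type) (E : J -> set T) (l : seq J) :
  (forall i, measurable (E i)) -> all_measurable (map E l).
Proof. by move=> mE; elim: l => //= i l IH. Qed.

Lemma measurable_setY E F :
  measurable E -> measurable F -> measurable (E `+` F).
Proof.
by move=> mE mF; rewrite /setY; apply: measurableU; exact: measurableD.
Qed.

End all_measurable_lemmas.

(** * Monotonicity, strong subadditivity and stability of the entropy of finite families *)

Section set_entropy_lemmas.
Context {R : realType} {d} {T : measurableType d}.
Variable mu : probability T R.
Implicit Types (A E F G : set T) (s t : seq (set T)).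

Definition pr A : R := fine (mu A).

Local Notation ce := (cell_entropy pr).
Local Notation ent := (set_entropy pr).

Lemma pr_EFin A : measurable A -> mu A = (pr A)%:E.
Proof. by move=> mA; rewrite /pr fineK// fin_num_measure. Qed.

Lemma pr_ge0 A : 0 <= pr A.
Proof. exact/fine_ge0/measure_ge0. Qed.

Lemma prT : pr setT = 1.
Proof. by rewrite /pr probability_setT. Qed.

Lemma pr0 : pr set0 = 0.
Proof. by rewrite /pr measure0. Qed.

Lemma le_pr A E : measurable A -> measurable E -> A `<=` E -> pr A <= pr E.
Proof.
by move=> mA mE AE; rewrite -lee_fin -!pr_EFin//; apply: le_measure;
  rewrite ?inE.
Qed.

Lemma pr_le1 A : measurable A -> pr A <= 1.
Proof. by move=> mA; rewrite -prT; exact: le_pr. Qed.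

Lemma pr_split A E : measurable A -> measurable E ->
  pr A = pr (A `&` E) + pr (A `\` E).
Proof.
move=> mA mE; apply: EFin_inj; rewrite EFinD -!pr_EFin//.
- by rewrite addeC -measureDI.
- exact: measurableD.
- exact: measurableI.
Qed.

Lemma prC A : measurable A -> pr (~` A) = 1 - pr A.
Proof.
by move=> mA; have := pr_split measurableT mA; rewrite setTI setTD prT; lra.
Qed.

Lemma prU_le A E : measurable A -> measurable E -> pr (A `|` E) <= pr A + pr E.
Proof.
move=> mA mE; rewrite -lee_fin EFinD -!pr_EFin//; last exact: measurableU.
exact: measureU2.
Qed.

Let mIE A E : measurable A -> measurable E -> measurable (A `&` E).
Proof. exact: measurableI. Qed.
Let mDE A E : measurable A -> measurable E -> measurable (A `\` E).
Proof. exact: measurableD. Qed.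
Hint Resolve mIE mDE : core.

Let setIDA A E F : (A `&` E) `\` F = (A `\` F) `&` E.
Proof. by rewrite !setDE setIAC. Qed.
Let setDDAC A E F : (A `\` E) `\` F = (A `\` F) `\` E.
Proof. by rewrite !setDDl setUC. Qed.

Lemma cell_entropy_null A s : measurable A -> all_measurable s -> pr A = 0 ->
  ce A s = 0.
Proof.
elim: s A => /= [|E s IH] A mA; first by move=> _ /= A0;
  rewrite A0 entropy_term0.
move=> [mE ms] A0; have := pr_split mA mE.
have := pr_ge0 (A `&` E); have := pr_ge0 (A `\` E); rewrite A0 => ? ? ?.
by rewrite !IH ?addr0//; [exact: mDE|lra|exact: mIE|lra].
Qed.

Lemma cell_entropy_swap A E F s : ce A (E :: F :: s) = ce A (F :: E :: s).
Proof.
by rewrite /= setIAC setIDA (setIDA A F) (setDDAC A E); ring.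
Qed.

Lemma cell_entropy_move A E s t : ce A (s ++ E :: t) = ce A (E :: s ++ t).
Proof.
elim: s A => // F s IH A; rewrite cat_cons (cell_entropy_swap A E F).
by rewrite [LHS]/= [RHS]/= !IH.
Qed.

(** Moved behind [s], the set [E] only splits the final cells, where [entropy_term] is
    subadditive. *)
Lemma cell_entropy_monotone A E s : measurable A -> measurable E ->
  all_measurable s -> ce A s <= ce A (E :: s).
Proof.
move=> + mE; elim: s A => [A mA _|F s IH A mA [mF ms]].
  rewrite /= (pr_split mA mE).
  by apply: entropy_termD_le; exact: pr_ge0.
rewrite cell_entropy_swap [leLHS]/= [leRHS]/=.
by apply: lerD; apply: IH => //; auto.
Qed.

(** Strong subadditivity. The defect is the mutual information of [E] and [F] conditioned on [s], a
    sum over the cells of [s]; within one cell it is the information of a 2 x 2 table. *)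
Lemma cell_entropy_submodular A E F s : measurable A -> measurable E ->
  measurable F -> all_measurable s ->
  ce A (E :: F :: s) + ce A s <= ce A (E :: s) + ce A (F :: s).
Proof.
move=> + mE mF; elim: s A => [A mA _|G s IH A mA [mG ms]].
  rewrite /= (pr_split mA mE) (pr_split (mIE mA mE) mF).
  rewrite (pr_split (mDE mA mE) mF) (pr_split (mIE mA mF) mE).
  rewrite (pr_split (mDE mA mF) mE) -(setIAC A E) -(setIDA A E).
  rewrite (setIDA A F) (setDDAC A F).
  have := @entropy_term_superadditive R (pr (A `&` E `&` F)) (pr ((A `\` E) `&`
    F))
    (pr (A `&` E `\` F)) (pr ((A `\` E) `\` F)) (pr_ge0 _) (pr_ge0 _)
    (pr_ge0 _) (pr_ge0 _).
  by rewrite addrACA; lra.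
have := IH _ (mIE mA mG) ms; have := IH _ (mDE mA mG) ms.
have -> : ce A (E :: F :: G :: s) = ce A (G :: E :: F :: s).
  by rewrite (cell_entropy_move A G [:: E; F]).
by rewrite (cell_entropy_swap A E G) (cell_entropy_swap A F G) /=; lra.
Qed.

Lemma entropy_nil : ent [::] = 0.
Proof. by rewrite /set_entropy /= prT entropy_term1. Qed.

Lemma entropy_set1 E : measurable E ->
  ent [:: E] = entropy_term (pr E) + entropy_term (1 - pr E).
Proof. by move=> mE; rewrite /set_entropy /= setTI setTD prC. Qed.

Lemma entropy_move E s t : ent (s ++ E :: t) = ent (E :: s ++ t).
Proof. exact: cell_entropy_move. Qed.

Lemma entropy_monotone E s : measurable E -> all_measurable s ->
  ent s <= ent (E :: s).
Proof. by move=> mE ms; exact: cell_entropy_monotone. Qed.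

Lemma entropy_ge0 s : all_measurable s -> 0 <= ent s.
Proof.
elim: s => [_|E s IH [mE ms]]; first by rewrite entropy_nil.
by apply: le_trans (entropy_monotone mE ms); exact: IH.
Qed.

(** Conditional entropy is represented throughout by such differences; this is the principle that
    further conditioning lowers it. *)
Lemma entropy_cond_le E s t : measurable E -> all_measurable s ->
  all_measurable t -> ent (E :: s ++ t) - ent (s ++ t) <= ent (E :: t) - ent t.
Proof.
move=> mE + mt; elim: s => //= F s IH [mF ms].
apply: le_trans (IH ms); have := cell_entropy_submodular measurableT mE mF
  (all_measurable_cat ms mt).
rewrite /set_entropy; lra.
Qed.

Lemma entropy_cons_le E s : measurable E -> all_measurable s ->
  ent (E :: s) <= ent [:: E] + ent s.
Proof.
move=> mE ms; have := @entropy_cond_le E s [::] mE ms I.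
by rewrite cats0 entropy_nil; lra.
Qed.

Lemma entropy_cat_le s t : all_measurable s -> all_measurable t ->
  ent (s ++ t) <= ent s + ent t.
Proof.
move=> + mt; elim: s => [_|E s IH [mE ms]]; first by rewrite entropy_nil add0r.
have := entropy_cond_le (s := t) mE mt ms.
have := IH ms.
have pC A : ce A (s ++ t) = ce A (t ++ s).
  by elim: t A {IH mt} => [|F t IH] A; rewrite ?cats0// cell_entropy_move /=
    !IH.
by rewrite /set_entropy cat_cons /= !pC; lra.
Qed.

Lemma entropy_filter_le (J : Type) (E : J -> set T) (b : pred J) (l : seq J) :
  (forall i, measurable (E i)) -> ent (map E (seq.filter b l)) <= ent (map E l).
Proof.
(* The prefix [s] collects the sets already treated, which both sides share; the later inductions on
   lists use the same device. *)
move=> mE; suff h s : all_measurable s ->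
    ent (s ++ map E (seq.filter b l)) <= ent (s ++ map E l) by exact: (h [::]).
elim: l s => //= i l IH s ms.
have mcat l' : all_measurable (s ++ map E l').
  by apply: all_measurable_cat => //; exact: all_measurable_map.
case: ifP => _ /=; last by rewrite entropy_move (le_trans (IH _ ms))//
  entropy_monotone.
by rewrite -!cat_rcons; apply: IH; rewrite -cats1; apply: all_measurable_cat.
Qed.

Lemma entropy_cond_filter_le F (J : Type) (E : J -> set T) (b : pred J)
    (l : seq J) : measurable F -> (forall i, measurable (E i)) ->
  ent (F :: map E l) - ent (map E l) <=
  ent (F :: map E (seq.filter b l)) - ent (map E (seq.filter b l)).
Proof.
move=> mF mE; suff h s : all_measurable s ->
    ent (F :: s ++ map E l) - ent (s ++ map E l) <=
    ent (F :: s ++ map E (seq.filter b l)) - ent (s ++ map E (seq.filter b l)).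
  exact: (h [::]).
elim: l s => //= i l IH s ms.
have mcat l' : all_measurable (s ++ map E l').
  by apply: all_measurable_cat => //; exact: all_measurable_map.
case: ifP => _ /=.
  by rewrite -!cat_rcons; apply: IH; rewrite -cats1; apply: all_measurable_cat.
apply: le_trans (IH s ms).
rewrite -cat_cons !entropy_move cat_cons.
have := @entropy_cond_le F [:: E i] (s ++ map E l) mF (conj (mE i) I) (mcat l).
by rewrite /set_entropy [in X in _ -> X](cell_entropy_swap setT (E i) F).
Qed.

(** Once [F] is known, [E] and its symmetric difference with [F] determine each other, so the same
    four cells occur in another order. *)
Lemma cell_entropy_setY A E F s :
  ce A (E :: F :: s) = ce A (F :: (E `+` F) :: s).
Proof.
(* Supplying excluded middle for [E] and [F] turns each cell identity into a propositional
   tautology. *)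
have eqs B C : (forall x, E x \/ ~ E x -> F x \/ ~ F x -> (B x <-> C x)) ->
    B = C.
  by move=> h; apply/seteqP; split=> x /(h x (EM _) (EM _)).
rewrite /= (eqs (A `&` F `&` (E `+` F)) ((A `\` E) `&` F));
  last by rewrite /setY/=; tauto.
rewrite (eqs (A `&` F `\` (E `+` F)) (A `&` E `&` F));
  last by rewrite /setY/=; tauto.
rewrite (eqs ((A `\` F) `&` (E `+` F)) (A `&` E `\` F));
  last by rewrite /setY/=; tauto.
rewrite (eqs ((A `\` F) `\` (E `+` F)) ((A `\` E) `\` F));
  last by rewrite /setY/=; tauto.
ring.
Qed.

(** Continuity in the Rokhlin metric: [F] together with the symmetric difference determines [E], so
    exchanging one set costs at most the entropy of that difference, whatever the rest of the family
    is. *)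
Lemma entropy_replace_le E F s : measurable E -> measurable F ->
  all_measurable s -> ent (E :: s) <= ent (F :: s) + ent [:: E `+` F].
Proof.
move=> mE mF ms; have mEF := measurable_setY mE mF.
have := @entropy_monotone F (E :: s) mF (conj mE ms).
rewrite /set_entropy cell_entropy_swap cell_entropy_setY cell_entropy_swap.
by have := @entropy_cons_le (E `+` F) (F :: s) mEF (conj mF ms);
  rewrite /set_entropy; lra.
Qed.

Lemma entropy_replace_map_le (J : eqType) (E F : J -> set T) (l : seq J)
    (c : R) :
    (forall i, measurable (E i)) -> (forall i, measurable (F i)) ->
    {in l, forall i, ent [:: E i `+` F i] <= c} ->
  ent (map E l) <= ent (map F l) + (size l)%:R * c.
Proof.
move=> mE mF; suff h s : all_measurable s ->
    {in l, forall i, ent [:: E i `+` F i] <= c} ->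
    ent (s ++ map E l) <= ent (s ++ map F l) + (size l)%:R * c.
  exact: (h [::] I).
elim: l s => [|i l IH] s ms hc; first by rewrite mul0r addr0.
have mcat (G : J -> set T) l' : (forall i, measurable (G i)) ->
    all_measurable (s ++ map G l').
  by move=> mG; apply: all_measurable_cat => //; exact: all_measurable_map.
rewrite [map _ _]/= entropy_move.
have h1 := entropy_replace_le (mE i) (mF i) (mcat E l mE).
have h2 := hc i (mem_head _ _).
have : ent (rcons s (F i) ++ map E l) <=
    ent (rcons s (F i) ++ map F l) + (size l)%:R * c.
  apply: IH; first by rewrite -cats1; apply: all_measurable_cat.
  by move=> j jl; apply: hc; rewrite inE jl orbT.
by rewrite !cat_rcons (entropy_move _ s (map E l)) /= -natr1; lra.
Qed.

Let cell_entropy_sub A G s : measurable A -> measurable G ->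
  all_measurable s -> A `<=` G -> ce A (G :: s) = ce A s.
Proof.
move=> mA mG ms AG; rewrite /= (setIidl AG) [X in _ + X]cell_entropy_null
  ?addr0//.
  exact: mDE.
by rewrite (_ : _ `\` _ = set0) ?pr0// setD_eq0.
Qed.

Let cell_entropy_disj A G s : measurable A -> measurable G ->
  all_measurable s -> A `&` G = set0 -> ce A (G :: s) = ce A s.
Proof.
move=> mA mG ms AG; rewrite /= AG cell_entropy_null ?pr0// add0r.
by congr ce; apply/setDidPl.
Qed.

(** Every cell cut out by [E] and [F] lies inside the intersection or is disjoint from it, so
    adjoining the intersection to both sets splits off only empty cells. *)
Lemma entropy_setI_le E F s : measurable E -> measurable F ->
  all_measurable s -> ent ((E `&` F) :: s) <= ent (E :: F :: s).
Proof.
move=> mE mF ms; have mEF : measurable (E `&` F) by exact: measurableI.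
apply: (le_trans (@entropy_monotone F (E `&` F :: s) mF (conj mEF ms))).
apply: (le_trans (@entropy_monotone E (F :: E `&` F :: s) mE (conj mF (conj mEF
  ms)))).
have h A : measurable A -> A `<=` E `&` F \/ A `&` (E `&` F) = set0 ->
    ce A ((E `&` F) :: s) = ce A s.
  by move=> mA [?|?]; [exact: cell_entropy_sub|exact: cell_entropy_disj].
rewrite /set_entropy.
have -> t : ce setT (E :: F :: t) =
    ce (setT `&` E `&` F) t + ce (setT `&` E `\` F) t +
    (ce ((setT `\` E) `&` F) t + ce ((setT `\` E) `\` F) t) by [].
rewrite !h//.
- by apply: mDE => //; exact: mDE.
- by right; rewrite -subset0 => x [[[_ ?] _] []].
- by apply: mIE => //; exact: mDE.
- by right; rewrite -subset0 => x [[[_ ?] _] []].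
- by apply: mDE => //; exact: mIE.
- by right; rewrite -subset0 => x [[[_ ?] ?] []].
- by apply: mIE => //; exact: mIE.
- by left; rewrite setTI.
Qed.

Lemma entropy_map_setI_le (J : Type) (E F : J -> set T) (l : seq J) :
    (forall i, measurable (E i)) -> (forall i, measurable (F i)) ->
  ent (map (fun i => E i `&` F i) l) <= ent (map E l) + ent (map F l).
Proof.
move=> mE mF; have mm (G : J -> set T) (mG : forall i, measurable (G i)) l' :
  all_measurable (map G l') by exact: all_measurable_map.
apply: le_trans (entropy_cat_le (mm _ mE l) (mm _ mF l)).
suff h s : all_measurable s ->
    ent (s ++ map (fun i => E i `&` F i) l) <= ent (s ++ (map E l ++ map F l)).
  exact: (h [::] I).
elim: l s => //= i l IH s ms; rewrite entropy_move.
apply: le_trans (entropy_setI_le (mE i) (mF i) _) _.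
  by apply: all_measurable_cat => //; apply: mm => j; exact: measurableI.
apply: (le_trans (IH [:: E i, F i & s] (conj (mE i) (conj (mF i) ms)))).
rewrite (entropy_move (E i)) (catA s (map E l)) -(cat_cons (E i)).
rewrite (entropy_move (F i)) !cat_cons -catA.
by rewrite /set_entropy cell_entropy_swap.
Qed.

End set_entropy_lemmas.

(** * Entropy along orbits *)

Definition orbit_sets (T : Type) (f : T -> T) (F : set T) (n : nat) :
    seq (set T) := [seq iter i f @^-1` F | i <- iota 0 n].

(** Vanishing entropy is expressed as sublinear growth, so it can be handled without any limit.
    Natural logarithms are used; the base changes only a constant factor. *)
Definition zero_entropy d (T : measurableType d) (R : realType)
    (mu : probability T R) (f : T -> T) (F : set T) : Prop :=
  forall e : R, 0 < e -> exists N : nat, forall n : nat, (N <= n)%N ->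
    set_entropy (pr mu) (orbit_sets f F n) <= e * n%:R.

(** * Nested cells versus cells indexed by itineraries *)

Section refined_partition_entropy.
Context {R : realType} {T : Type}.
Implicit Types (m : set T -> R) (E : nat -> set T).

Let cell E n (w : {ffun 'I_n -> bool}) : set T :=
  \bigcap_(i : 'I_n) two_set_partition (E i) (w i).

Let cons_ffun n (p : bool * {ffun 'I_n -> bool}) : {ffun 'I_n.+1 -> bool} :=
  [ffun i => if unlift ord0 i is Some j then p.2 j else p.1].

Let cons_ffun_bij n : bijective (@cons_ffun n).
Proof.
exists (fun w : {ffun 'I_n.+1 -> bool} => (w ord0, [ffun j => w (lift ord0
  j)])).
  move=> [b w]; congr pair; first by rewrite ffunE unlift_none.
  by apply/ffunP => j; rewrite !ffunE liftK.
move=> w; apply/ffunP => i; rewrite ffunE /=.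
by case: unliftP => [j|] ->; rewrite ?ffunE.
Qed.

Let cell_cons E n b (w : {ffun 'I_n -> bool}) :
  cell E (cons_ffun (b, w)) =
  two_set_partition (E 0%N) b `&` cell (fun i => E i.+1) w.
Proof.
apply/seteqP; split=> [x h|x [h0 h] i _]; rewrite ?ffunE.
  split=> [|j _].
    by have := h ord0 I; rewrite ffunE unlift_none.
  by have := h (lift ord0 j) I; rewrite ffunE liftK.
by case: unliftP => [j|] ->//; have := h j I.
Qed.

Lemma cell_entropyE m A E n :
  cell_entropy m A [seq E i | i <- iota 0 n] =
  \sum_(w : {ffun 'I_n -> bool}) entropy_term (m (A `&` cell E w)).
Proof.
elim: n A E => [|n IH] A E.
  rewrite (big_pred1 [ffun i => true]) => [|w]; last first.
    by apply/esym/eqP/ffunP => -[].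
  by rewrite /= (_ : cell E _ = setT) ?setIT//; apply/seteqP; split=> // x _ [].
rewrite (reindex (@cons_ffun n)); last exact/onW_bij/cons_ffun_bij.
rewrite -(pair_bigA _ (fun b w => entropy_term (m (A `&` cell E (cons_ffun (b,
  w)))))).
rewrite /= big_bool/=.
have -> : iota 1 n = map S (iota 0 n) by rewrite (iotaDl 1).
rewrite -map_comp (IH _ (fun i => E i.+1)) (IH _ (fun i => E i.+1)).
by congr (_ + _); apply: eq_bigr => w _; rewrite cell_cons setIA.
Qed.

(** Valid for a bare set function, as needed for [average_measure], which is not packaged as a
    probability. *)
Lemma partition_entropyE (nu : set T -> \bar R) f F n :
  partition_entropy nu (@refined_partition T f _ (two_set_partition F) n) =
  set_entropy (fine \o nu) (orbit_sets f F n) / ln 2.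
Proof.
rewrite /set_entropy cell_entropyE mulr_suml /partition_entropy -sumrN.
apply: eq_bigr => w _; rewrite /entropy_term /log2 setTI /= mulrA mulNr.
suff -> : refined_partition f (two_set_partition F) w =
  cell (fun i => iter i f @^-1` F) w by [].
rewrite /refined_partition /cell; apply: eq_bigcapr => i _.
by case: (w i).
Qed.

Lemma dynamical_entropyE (nu : set T -> \bar R) f F :
  dynamical_entropy nu f (two_set_partition F) =
  limn (fun n => n%:R^-1 *
    (set_entropy (fine \o nu) (orbit_sets f F n) / ln 2)).
Proof.
by congr (limn _); apply/funext => n; rewrite partition_entropyE.
Qed.

Lemma cell_entropy_preimage (T' : Type) (g : T' -> T) (m' : set T' -> R) A s :
  cell_entropy m' (g @^-1` A) (map (preimage g) s) =
  cell_entropy (fun B => m' (g @^-1` B)) A s.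
Proof. by elim: s A => //= E s IH A; rewrite -!IH. Qed.

End refined_partition_entropy.

(** * Entropy increments and growth of entropy along orbits *)

Section orbit_entropy.
Context {R : realType} {d} {T : measurableType d}.
Variables (mu : probability T R) (f : T -> T).
Hypotheses (mf : measurable_fun setT f) (muf : invariant_measure mu f).
Implicit Types (F D : set T) (c e : R).

Local Notation ent := (set_entropy (pr mu)).
Local Notation orb i F := (iter i f @^-1` F).

Lemma measurable_preimage F : measurable F -> measurable (f @^-1` F).
Proof. by move=> mF; rewrite -[X in measurable X]setTI; exact: mf. Qed.

Lemma preimage_iterS i F : orb i.+1 F = f @^-1` (orb i F).
Proof. by apply/seteqP; split => x; rewrite /preimage /= -iterSr. Qed.

Lemma measurable_iter_preimage F i : measurable F -> measurable (orb i F).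
Proof.
by move=> mF; elim: i => // i IH; rewrite preimage_iterS;
  exact: measurable_preimage.
Qed.

Lemma mu_iter_preimage F i : measurable F -> mu (orb i F) = mu F.
Proof.
move=> mF; elim: i => // i IH; rewrite preimage_iterS muf//.
exact: measurable_iter_preimage.
Qed.

Lemma entropy_preimage s : all_measurable s ->
  ent (map (preimage f) s) = ent s.
Proof.
rewrite /set_entropy -{1}(preimage_setT f); move: setT (@measurableT _ T).
elim: s => [|E s IH] A mA /=; first by move=> _; rewrite /pr muf.
by move=> [mE ms]; rewrite -!IH//; [exact: measurableD|exact: measurableI].
Qed.

Lemma entropy_shift F (l : seq nat) a : measurable F ->
  ent [seq orb (a + i) F | i <- l] = ent [seq orb i F | i <- l].
Proof.
move=> mF; elim: a => // a <-.
rewrite -[RHS]entropy_preimage; last first.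
  by apply: all_measurable_map => i; exact: measurable_iter_preimage.
by rewrite -map_comp; congr ent; apply: eq_map => i; rewrite /= preimage_iterS.
Qed.

Definition entropy_increment F n : R :=
  ent (orbit_sets f F n.+1) - ent (orbit_sets f F n).

Local Notation incr := entropy_increment.

Let mseq F (l : seq nat) : measurable F ->
  all_measurable [seq orb i F | i <- l].
Proof.
by move=> mF; apply: all_measurable_map => i; exact: measurable_iter_preimage.
Qed.

(** By stationarity the two terms can be shifted independently. The increment thereby becomes the
    entropy of the preimage at time [a] conditioned on the next [n] preimages, the form in which
    increments can be compared. *)
Lemma entropy_incrementE F a n : measurable F ->
  incr F n = ent [seq orb i F | i <- iota a n.+1] -
             ent [seq orb i F | i <- iota a.+1 n].
Proof.
move=> mF; rewrite -[in iota a _](addn0 a) -[in iota a.+1 _](addn0 a.+1).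
by rewrite !iotaDl -!map_comp !entropy_shift.
Qed.

Lemma entropy_increment_nonincreasing F n m : measurable F -> (n <= m)%N ->
  incr F m <= incr F n.
Proof.
move=> mF nm; rewrite (entropy_incrementE 0 m mF) (entropy_incrementE 0 n mF)
  /=.
rewrite -[iota 1 n](filter_iota_ltn 1 nm); apply: entropy_cond_filter_le => //.
by move=> i; exact: measurable_iter_preimage.
Qed.

Lemma orbit_entropy0 F : ent (orbit_sets f F 0) = 0.
Proof. exact: entropy_nil. Qed.

Lemma orbit_entropyS F n :
  ent (orbit_sets f F n.+1) = ent (orbit_sets f F n) + incr F n.
Proof. by rewrite /incr addrC subrK. Qed.

Lemma orbit_entropy_ge F n c : (forall k, c <= incr F k) ->
  c * n%:R <= ent (orbit_sets f F n).
Proof.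
move=> h; elim: n => [|n IH]; first by rewrite mulr0 orbit_entropy0.
by rewrite orbit_entropyS -natr1; have := h n; lra.
Qed.

Lemma entropy_increment_le_mean F n : measurable F ->
  incr F n * n%:R <= ent (orbit_sets f F n).
Proof.
move=> mF; elim: n => [|n IH]; first by rewrite mulr0 orbit_entropy0.
rewrite orbit_entropyS -natr1.
have := ler_wpM2r (ler0n R n) (entropy_increment_nonincreasing mF (leqnSn n)).
have := entropy_increment_nonincreasing mF (leqnSn n); lra.
Qed.

(** From time [k] on all increments stay below [c]; the factor 2 absorbs the entropy already
    accumulated by then. *)
Lemma orbit_entropy_eventually F c k : measurable F -> 0 < c -> incr F k < c ->
  exists N, forall n, (N <= n)%N -> ent (orbit_sets f F n) <= 2 * c * n%:R.
Proof.
move=> mF c0 hk.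
have le1 n : (k <= n)%N -> ent (orbit_sets f F n) <=
    ent (orbit_sets f F k) + c * (n - k)%:R.
  move=> kn; rewrite -[in leLHS](subnKC kn); elim: (n - k)%N => [|j IH].
    by rewrite addn0 mulr0 addr0.
  rewrite addnS orbit_entropyS -(natr1 j).
  by have := entropy_increment_nonincreasing mF (leq_addr j k); lra.
have a0 : 0 <= ent (orbit_sets f F k) by apply: entropy_ge0; exact: mseq.
have [N hN] : exists N : nat, ent (orbit_sets f F k) <= c * N%:R.
  exists (Num.truncn (ent (orbit_sets f F k) / c)).+1.
  by rewrite mulrC -ler_pdivrMr//; apply: ltW; apply: truncnS_gt.
exists (maxn k N) => n; rewrite geq_max => /andP[kn Nn].
have := le1 n kn.
have : c * (n - k)%:R <= c * n%:R.
  by apply: ler_wpM2l; [exact: ltW|rewrite ler_nat leq_subr].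
have : c * N%:R <= c * n%:R by apply: ler_wpM2l; [exact: ltW|rewrite ler_nat].
by lra.
Qed.

Lemma zero_entropy_increment F : measurable F ->
  (forall c, 0 < c -> exists k, incr F k < c) -> zero_entropy mu f F.
Proof.
move=> mF h e e0; have e20 : 0 < e / 2 by lra.
have [k hk] := h _ e20; have [N hN] := orbit_entropy_eventually mF e20 hk.
by exists N => n /hN; lra.
Qed.

(** Positive entropy in its usable form: one constant for all increments, ready for selections of
    times along an orbit. *)
Lemma entropy_increment_bounded_below F : measurable F ->
  ~ zero_entropy mu f F -> exists2 c, 0 < c & forall k, c <= incr F k.
Proof.
move=> mF nz; apply: contrapT => h; apply: nz.
apply: zero_entropy_increment => // c c0.
apply: contrapT => h'; apply: h; exists c => // k.
by rewrite leNgt; apply/negP => hk; apply: h'; exists k.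
Qed.

(* By the chain rule each selected set contributes its entropy conditioned on
   the later selected ones, which is at least that conditioned on all later
   sets. *)
Lemma suborbit_entropy_ge F c (b : pred nat) a n : measurable F ->
  (forall k, c <= incr F k) ->
  c * (count b (iota a n))%:R <=
  ent [seq orb i F | i <- iota a n & b i].
Proof.
move=> mF h; elim: n a => [|n IH] a; first by rewrite mulr0 entropy_nil.
have mo i : measurable (orb i F) by exact: measurable_iter_preimage.
have := IH a.+1; rewrite /=; case: (b a); rewrite /= ?add0n// add1n -natr1.
have := @entropy_cond_filter_le _ _ _ mu _ _ (fun i => orb i F) b (iota a.+1 n)
  (mo a) mo.
by have := h n; rewrite (entropy_incrementE a n mF) /=; lra.
Qed.

Lemma is_cvg_mean_entropy F : measurable F ->
  cvgn (fun n => n%:R^-1 * (ent (orbit_sets f F n) / ln 2)).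
Proof.
move=> mF; set u := fun n : nat => _.
have ln20 : 0 < ln 2 :> R by apply: ln_gt0; lra.
(* The means decrease only from index 1 on: since the inverse of 0 is 0, the term at index 0 is
   0. *)
suff : cvgn [sequence u n.+1]_n.
  by case/cvg_ex => /= l; rewrite cvg_shiftS => ul; apply/cvg_ex; exists l.
have u0 n : 0 <= u n.
  rewrite /u mulr_ge0 ?invr_ge0//; apply: divr_ge0; last exact: ltW.
  by apply: entropy_ge0; exact: mseq.
have ud n : u n.+2 <= u n.+1.
  rewrite /u !mulrA ler_pM2r ?invr_gt0// ler_pdivrMl ?ltr0n// mulrCA.
  rewrite ler_pdivlMl ?ltr0n//; have := entropy_increment_le_mean n.+1 mF.
  by rewrite (orbit_entropyS F n.+1) -(natr1 n.+1); lra.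
apply: nonincreasing_is_cvgn; last by exists 0 => _ [n _ <-]; exact: u0.
by apply/nonincreasing_seqP => n; exact: ud.
Qed.

Lemma dynamical_entropy_gt0P F : measurable F ->
  0 < limn (fun n => n%:R^-1 * (ent (orbit_sets f F n) / ln 2)) <->
  ~ zero_entropy mu f F.
Proof.
move=> mF; have ln20 : 0 < ln 2 :> R by apply: ln_gt0; lra.
set u := fun n : nat => _; split=> [lim0 z|nz].
  (* With half the limit as growth rate, and [ln 2] converting the base, the limit would be at most
     half of itself. *)
  have {z}[N hN] := z (limn u / 2 * ln 2) ltac:(apply: mulr_gt0 => //; lra).
  suff : limn u <= limn u / 2 by lra.
  apply: limr_le; first exact: is_cvg_mean_entropy.
  exists N.+1 => // n /= Nn; have n0 : (0 < n)%N by exact: leq_trans Nn.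
  rewrite /u ler_pdivrMl ?ltr0n// ler_pdivrMr//.
  by rewrite -[leRHS]mulrA [leRHS]mulrC; apply: hN; exact: ltnW.
have [c c0 hc] := entropy_increment_bounded_below mF nz.
apply: (@lt_le_trans _ _ (c / ln 2)); first exact: divr_gt0.
apply: limr_ge; first exact: is_cvg_mean_entropy.
exists 1%N => // n /= n0; rewrite /u ler_pdivlMl ?ltr0n// mulrA.
by rewrite ler_pM2r ?invr_gt0// mulrC orbit_entropy_ge.
Qed.

Lemma orbit_entropy_replace_le E F c n : measurable E -> measurable F ->
  ent [:: E `+` F] <= c ->
  ent (orbit_sets f E n) <= ent (orbit_sets f F n) + n%:R * c.
Proof.
move=> mE mF hc; rewrite -[n in n%:R](size_iota 0 n).
apply: entropy_replace_map_le => [i|i|i _]; try exact: measurable_iter_preimage.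
have -> : orb i E `+` orb i F = orb i (E `+` F) by [].
suff -> : ent [:: orb i (E `+` F)] = ent [:: E `+` F] by [].
by have := @entropy_shift (E `+` F) [:: 0%N] i (measurable_setY mE mF);
  rewrite /= addn0.
Qed.

(** Replacing [F] by [E] costs at each time at most the entropy of their symmetric difference, which
    is as small as desired; the total error is then linear with small slope. *)
Lemma zero_entropy_approx F : measurable F ->
  (forall r, 0 < r -> exists2 E, measurable E &
    zero_entropy mu f E /\ pr mu (F `+` E) < r) ->
  zero_entropy mu f F.
Proof.
move=> mF h e e0; have [r r0 hr] := binary_entropy_small (e := e / 2)
  ltac:(lra).
have [E mE [zE FE]] := h r r0; have [N hN] := zE (e / 2) ltac:(lra).
exists N => n Nn; have := hN n Nn.
have := @orbit_entropy_replace_le F E (e / 2) n mF mE.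
rewrite entropy_set1; last exact: measurable_setY.
by move=> /(_ (hr _ _)); rewrite pr_ge0 FE => /(_ isT); lra.
Qed.

Lemma zero_entropyI E F : measurable E -> measurable F ->
  zero_entropy mu f E -> zero_entropy mu f F -> zero_entropy mu f (E `&` F).
Proof.
move=> mE mF zE zF e e0; have [N hN] := zE (e / 2) ltac:(lra).
have [M hM] := zF (e / 2) ltac:(lra).
exists (maxn N M) => n; rewrite geq_max => /andP[Nn Mn].
have := hN n Nn; have := hM n Mn.
have := @entropy_map_setI_le _ _ _ mu _ (fun i => orb i E) (fun i => orb i F)
  (iota 0 n) (fun i => measurable_iter_preimage i mE)
  (fun i => measurable_iter_preimage i mF).
by rewrite /orbit_sets; lra.
Qed.

Lemma zero_entropy_trivial F : measurable F -> pr mu F = 0 \/ pr mu F = 1 ->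
  zero_entropy mu f F.
Proof.
move=> mF F01 e e0; exists 0%N => n _.
suff : ent (orbit_sets f F n) <= 0.
  by move=> /le_trans; apply; rewrite mulr_ge0// ltW.
rewrite /orbit_sets; elim: (iota 0 n) => [|i l IH] /=;
  first by rewrite entropy_nil.
have mi := measurable_iter_preimage i mF.
have := entropy_cons_le mu mi (mseq l mF).
suff -> : ent [:: orb i F] = 0 by rewrite add0r => /le_trans; apply.
rewrite entropy_set1// /pr mu_iter_preimage// -/(pr mu F).
by case: F01 => ->; rewrite ?subrr ?subr0 entropy_term0 entropy_term1 addr0.
Qed.

End orbit_entropy.

(** * Sections of sets of zero entropy *)

Section sections_of_product.
Context {R : realType} {d1 d2 : measure_display}.
Context {T1 : measurableType d1} {T2 : measurableType d2}.
Variables (mu : probability T1 R) (nu : probability T2 R).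
Implicit Types (G : set (T1 * T2)) (D : set T2) (x : T1).

Let lambda : probability (T1 * T2)%type R := (mu \x nu)%E.

Let xsectionT x : xsection [set: T1 * T2] x = setT.
Proof. by rewrite xsectionE preimage_setT. Qed.

Lemma product_pr_int A : measurable A ->
  (\int[mu]_x (pr nu (xsection A x))%:E)%E = (pr lambda A)%:E.
Proof.
move=> mA; rewrite -pr_EFin// -[RHS]/(\int[mu]_x (nu \o xsection A) x)%E.
by apply: eq_integral => x _; rewrite /= pr_EFin//; exact: measurable_xsection.
Qed.

Lemma measurable_pr_xsection A : measurable A ->
  measurable_fun setT (fun x => pr nu (xsection A x)).
Proof.
move=> mA; have := measurable_fun_xsection nu mA.
by move=> h; apply: (measurableT_comp (f := fine)) h; exact: fine_measurable.
Qed.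

Lemma xsection_negligible A : measurable A -> lambda A = 0%E ->
  {ae mu, forall x, nu (xsection A x) = 0%E}.
Proof.
move=> mA A0.
have := @ae_eq_integral_abs _ _ _ mu setT measurableT (nu \o xsection A)
  (measurable_fun_xsection nu mA).
rewrite (eq_integral (nu \o xsection A)) => [|x _]; last by rewrite gee0_abs.
move=> [+ _] => /(_ A0); apply: filterS => x; exact.
Qed.

Lemma all_measurable_xsection (s : seq (set (T1 * T2))) x : all_measurable s ->
  all_measurable (map (fun A => xsection A x) s).
Proof.
by elim: s => //= A s IH [mA ms]; split; [exact: measurable_xsection|exact: IH].
Qed.

Let xcell A s x := cell_entropy (pr nu) (xsection A x)
  (map (fun B => xsection B x) s).

Let xcell_cons A B s x : xcell A (B :: s) x =
  xcell (A `&` B) s x + xcell (A `\` B) s x.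
Proof. by rewrite /xcell /= -xsectionI -xsectionD. Qed.

Lemma cell_entropy_ge0 d (T : measurableType d) (P : probability T R) A s :
  measurable A -> all_measurable s -> 0 <= cell_entropy (pr P) A s.
Proof.
elim: s A => /= [A mA _|B s IH A mA [mB ms]].
  by rewrite entropy_term_ge0// pr_ge0 pr_le1.
by rewrite addr_ge0// IH//; [exact: measurableI|exact: measurableD].
Qed.

Let xcell_ge0 A s x : measurable A -> all_measurable s -> 0 <= xcell A s x.
Proof.
move=> mA ms; apply: cell_entropy_ge0; first exact: measurable_xsection.
exact: all_measurable_xsection.
Qed.

Let measurable_xcell A s : measurable A -> all_measurable s ->
  measurable_fun setT (xcell A s).
Proof.
elim: s A => /= [A mA _|B s IH A mA [mB ms]].
  have mp := measurable_pr_xsection mA.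
  rewrite /xcell /= /entropy_term; apply: measurableT_comp => //.
  by apply: measurable_funM => //; apply: measurableT_comp mp;
    exact: measurable_ln.
rewrite (_ : xcell A _ = xcell (A `&` B) s \+ xcell (A `\` B) s); last first.
  by apply/funext => x; rewrite xcell_cons.
by apply: measurable_funD; apply: IH => //; [exact: measurableI|exact:
  measurableD].
Qed.

(* Jensen's inequality for [entropy_term], by integrating its tangent. *)
Let xcell_nil_int A : measurable A ->
  (\int[mu]_x (xcell A [::] x)%:E <= (entropy_term (pr lambda A))%:E)%E.
Proof.
move=> mA; set s := pr lambda A.
have p0 x : 0 <= pr nu (xsection A x) <= 1.
  by rewrite pr_ge0 pr_le1//; exact: measurable_xsection.
have mp := measurable_pr_xsection mA.
have := pr_ge0 lambda A; rewrite -/s le_eqVlt => /predU1P[s0|s0].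
  (* The tangent exists only at a positive mean. When the mean is 0, almost every fibre is null and
     the integrand vanishes almost everywhere. *)
  have : lambda A = 0%E by rewrite pr_EFin// -/s -s0.
  move=> /(xsection_negligible mA) n0.
  rewrite -s0 entropy_term0 le_eqVlt; apply/orP; left; apply/eqP.
  rewrite (_ : 0%:E = \int[mu]_x cst 0 x)%E; last by rewrite integral_cst//
    mul0e.
  apply: ae_eq_integral => //; first exact/measurable_EFinP/measurable_xcell.
  by move: n0; apply: filterS => x h _; rewrite /xcell /= /pr h entropy_term0.
have s1 : s <= 1 by exact: pr_le1.
have c0 : 0 <= - ln s by rewrite oppr_ge0 ln_le0.
have mln : measurable_fun setT (fun x => (pr nu (xsection A x))%:E).
  exact/measurable_EFinP.
have : (\int[mu]_x (xcell A [::] x + pr nu (xsection A x))%:E <=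
        \int[mu]_x ((- ln s)%:E * (pr nu (xsection A x))%:E + s%:E))%E.
  apply: ge0_le_integral => //.
  - by move=> x _; rewrite lee_fin addr_ge0 ?xcell_ge0//; case/andP : (p0 x).
  - by apply/measurable_EFinP/measurable_funD => //; exact: measurable_xcell.
  - by apply: emeasurable_funD => //; exact: measurable_funeM.
  - move=> x _; rewrite -EFinM -EFinD lee_fin /xcell /=.
    by have /andP[+ _] := p0 x => /(@entropy_term_le_tangent R _ s) /(_ s0);
      lra.
under eq_integral do rewrite EFinD.
rewrite ge0_integralD//; last first.
- by move=> x _; rewrite lee_fin pr_ge0.
- exact/measurable_EFinP/measurable_xcell.
- by move=> x _; rewrite lee_fin xcell_ge0.
rewrite ge0_integralD//; last first.
- by move=> x _; rewrite lee_fin ltW.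
- exact: measurable_funeM.
- by move=> x _; rewrite -EFinM lee_fin mulr_ge0// pr_ge0.
rewrite ge0_integralZl//; last first.
- by move=> x _; rewrite lee_fin pr_ge0.
rewrite product_pr_int// integral_cst//.
rewrite [X in (s%:E * X)%E](probability_setT mu) mule1 -/s.
rewrite -EFinM leeD2rE// => /le_trans; apply.
by rewrite lee_fin /entropy_term mulrC mulrN.
Qed.

(** The left side is the entropy of [s] conditioned on the first coordinate; Jensen's inequality is
    applied to each cell and summed. *)
Lemma xsection_entropy_int s : all_measurable s ->
  (\int[mu]_x (set_entropy (pr nu) (map (fun B => xsection B x) s))%:E <=
   (set_entropy (pr lambda) s)%:E)%E.
Proof.
suff h A : measurable A -> all_measurable s ->
    (\int[mu]_x (xcell A s x)%:E <= (cell_entropy (pr lambda) A s)%:E)%E.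
  move=> /(h setT measurableT); congr (_ <= _)%E; apply: eq_integral => x _.
  by rewrite /xcell xsectionT.
elim: s A => [A mA _|B s IH A mA [mB ms]]; first exact: xcell_nil_int.
under eq_integral do rewrite xcell_cons EFinD.
have mAB := measurableI _ _ mA mB; have mADB := measurableD mA mB.
rewrite ge0_integralD//.
- by rewrite /= EFinD; apply: leeD; exact: IH.
- by move=> x _; rewrite lee_fin xcell_ge0.
- exact/measurable_EFinP/measurable_xcell.
- by move=> x _; rewrite lee_fin xcell_ge0.
- exact/measurable_EFinP/measurable_xcell.
Qed.

Lemma measurable_xsection_entropy s : all_measurable s ->
  measurable_fun setT
    (fun x => set_entropy (pr nu) (map (fun B => xsection B x) s)).
Proof.
move=> ms; have := measurable_xcell measurableT ms.
by congr measurable_fun; apply/funext => x; rewrite /xcell xsectionT.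
Qed.

End sections_of_product.

(** * Separability of the family of fibres of a measurable set *)

Section approximation_of_sections.
Context {R : realType} {d1 d2 : measure_display}.
Context {T1 : measurableType d1} {T2 : measurableType d2}.
Variable (nu : probability T2 R).
Implicit Types (G H : set (T1 * T2)) (D : nat -> set T2).

Lemma pr_setY_triangle d (T : measurableType d) (P : probability T R) A B C :
  measurable A -> measurable B -> measurable C ->
  pr P (A `+` C) <= pr P (A `+` B) + pr P (B `+` C).
Proof.
move=> mA mB mC.
have mAB := measurable_setY mA mB; have mBC := measurable_setY mB mC.
apply: le_trans (prU_le P mAB mBC); apply: le_pr.
- exact: measurable_setY.
- exact: measurableU.
- by move=> x; rewrite /setY /= => -[[a c]|[c a]];
  have [b|b] := pselect (B x); tauto.
Qed.

(** The order of quantifiers matters: one sequence [D] serves all base points [x]. *)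
Let approximable G := exists2 D : nat -> set T2, forall k, measurable (D k) &
  forall x e, 0 < e -> exists k, pr nu (xsection G x `+` D k) < e.

Let measurable_approximable G := measurable G /\ approximable G.

Let approximable0 : measurable_approximable set0.
Proof.
split=> //; exists (fun=> set0) => // x e e0; exists 0%N.
by rewrite xsection0 setYK pr0.
Qed.

Let approximableC G : measurable_approximable G -> measurable_approximable (~`
  G).
Proof.
move=> [mG [D mD h]]; split; first exact: measurableC.
exists (fun k => ~` D k) => [k|x e e0]; first exact: measurableC.
have [k hk] := h x e e0; exists k.
rewrite (_ : _ `+` _ = xsection G x `+` D k)//.
apply/seteqP; rewrite !xsectionE /setY; split=> y /=;
  by have [] := pselect (G (x, y)); have [] := pselect (D k y); tauto.
Qed.

Let approximableU G H : measurable_approximable G -> measurable_approximable H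
  ->
  measurable_approximable (G `|` H).
Proof.
move=> [mG [D mD hD]] [mH [E mE hE]]; split; first exact: measurableU.
pose F k := if unpickle k is Some (i, j) then D i `|` E j else set0.
exists F => [k|x e e0].
  by rewrite /F; case: unpickle => [[i j]|]//; exact: measurableU.
have e20 : 0 < e / 2 by lra.
have [i hi] := hD x _ e20; have [j hj] := hE x _ e20.
exists (pickle (i, j)); rewrite /F pickleK.
have mGD := measurable_setY (measurable_xsection x mG) (mD i).
have mHE := measurable_setY (measurable_xsection x mH) (mE j).
apply: (@le_lt_trans _ _ (pr nu ((xsection G x `+` D i) `|` (xsection H x `+` E
  j)))).
  apply: le_pr.
  - apply: measurable_setY; last exact: measurableU.
    by apply: measurable_xsection; exact: measurableU.
  - exact: measurableU.
  - by move=> y; rewrite !xsectionE /setY /=;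
      have [] := pselect (G (x, y)); have [] := pselect (H (x, y)); tauto.
by have := prU_le nu mGD mHE; lra.
Qed.

Let approximable_bigcup (G : nat -> set (T1 * T2)) :
  (forall i, measurable_approximable (G i)) ->
  measurable_approximable (\bigcup_i G i).
Proof.
move=> hG; pose H n := \big[setU/set0]_(i < n) G i.
have hH n : measurable_approximable (H n).
  by rewrite /H; elim/big_ind : _ => //; exact: approximableU.
have mU : measurable (\bigcup_i G i).
  by apply: bigcupT_measurable => i; case: (hG i).
split=> //; have D_ n : {D : nat -> set T2 | (forall k, measurable (D k)) &
  forall x e, 0 < e -> exists k, pr nu (xsection (H n) x `+` D k) < e}.
  by apply: cid2; case: (hH n).
pose D n := s2val (D_ n).
pose F k := if unpickle k is Some (i, j) then D i j else set0.
exists F => [k|x e e0].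
  by rewrite /F; case: unpickle => [[i j]|]//; exact: (s2valP (D_ i)).
have mHx n : measurable (xsection (H n) x).
  by apply: measurable_xsection; case: (hH n).
have mUx : measurable (xsection (\bigcup_i G i) x) by exact:
  measurable_xsection.
(* The stage [n] depends on [x], which is harmless because [F] enumerates the approximating sets of
   all stages at once. *)
have [n hn] : exists n, pr nu (xsection (\bigcup_i G i) x `+` xsection (H n) x)
  < e / 2.
  have HU : \bigcup_n xsection (H n) x = xsection (\bigcup_i G i) x.
    rewrite -xsection_bigcup; congr xsection; rewrite /H.
    apply/seteqP; split=> z [n _]; first by rewrite -bigcup_mkord => -[i _];
      exists i.
    by exists n.+1 => //; rewrite -bigcup_mkord; exists n => /=.
  have : (fun n => nu (xsection (H n) x)) @ \oo -->
      (pr nu (xsection (\bigcup_i G i) x))%:E.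
    rewrite -pr_EFin// -HU; apply: nondecreasing_cvg_mu => //;
      first by rewrite HU.
    move=> i j ij; apply/subsetPset => y; rewrite !xsectionE /=.
    exact: (@subset_bigsetU _ G _ _ ij (x, y)).
  move=> /fine_cvgP[_] /cvgr_dist_lt /(_ (e / 2) ltac:(lra)) [N _ /(_ N (leqnn
    N))] /= hN.
  exists N; rewrite /setY (_ : xsection (H N) x `\` _ = set0) ?setU0;
    last first.
    by rewrite setD_eq0 -HU => y hy; exists N.
  have := pr_split nu mUx (mHx N); rewrite setIidr;
    last by rewrite -HU => y hy; exists N.
  by move: hN; rewrite /pr /= => /(le_lt_trans (ler_norm _)); lra.
have [k hk] := s2valP' (D_ n) x (e / 2) ltac:(lra).
exists (pickle (n, k)); rewrite /F pickleK.
have := pr_setY_triangle nu mUx (mHx n) (s2valP (D_ n) k).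
by move: hn hk; rewrite -/(D n); lra.
Qed.

(** The space [T2] is arbitrary and its measure algebra may be nonseparable, but the fibres of one
    set [G] always form a separable family: the sets with this property form a sigma-algebra
    containing the rectangles, whose fibres take only two values. *)
Lemma xsection_approximation G : measurable G ->
  exists2 D : nat -> set T2, forall k, measurable (D k) &
  forall x e, 0 < e -> exists k, pr nu (xsection G x `+` D k) < e.
Proof.
move=> mG; suff : measurable_approximable G by case.
move: mG; rewrite measurable_prod_measurableType.
apply: (smallest_sub (X := measurable_approximable)) => [|_ [A mA [B mB <-]]].
  split; [exact: approximable0| |exact: approximable_bigcup].
  by move=> A; rewrite setTD; exact: approximableC.
split; first exact: measurableX.
exists (fun k => if k is 0%N then set0 else B) => [[]//|x e e0].
have [xA|xA] := boolP (x \in A).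
  by exists 1%N; rewrite in_xsectionX// setYK pr0.
by exists 0%N; rewrite notin_xsectionX// setYK pr0.
Qed.

End approximation_of_sections.

(** * Almost every fibre of a set of zero entropy has zero entropy *)

Section zero_entropy_sections.
Context {R : realType} {d1 d2 : measure_display}.
Context {T1 : measurableType d1} {T2 : measurableType d2}.
Variables (mu : probability T1 R) (nu : probability T2 R).
Variables (f : T1 -> T1) (g : T2 -> T2).
Hypotheses (mf : measurable_fun setT f) (mg : measurable_fun setT g).
Hypotheses (muf : invariant_measure mu f) (nug : invariant_measure nu g).

Definition product_map (z : T1 * T2) := (f z.1, g z.2).

Local Notation ent P := (set_entropy (pr P)).

Let lambda : probability (T1 * T2)%type R := (mu \x nu)%E.

Lemma measurable_product_map : measurable_fun setT product_map.
Proof.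
apply/measurable_fun_pairP; split.
  exact: (measurableT_comp mf measurable_fst).
exact: (measurableT_comp mg measurable_snd).
Qed.

Lemma product_map_invariant : invariant_measure lambda product_map.
Proof.
move=> A mA; pose h := measurable_product_map.
pose m : {mfun (T1 * T2)%type >-> (T1 * T2)%type} :=
  HB.pack product_map (isMeasurableFun.Build _ _ _ _ product_map h).
apply/esym/(@product_measure_unique _ _ _ _ R mu nu (distribution lambda m)) =>
  //.
move=> B C mB mC.
rewrite /= /distribution /pushforward (_ : _ @^-1` _ = (f @^-1` B) `*` (g @^-1`
  C))//.
rewrite product_measure1E; [|exact: measurable_preimage..].
by congr (_ * _)%E; [exact: muf|exact: nug].
Qed.

Lemma iter_product_map n x y :
  iter n product_map (x, y) = (iter n f x, iter n g y).
Proof. by elim: n => //= n ->. Qed.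

Lemma xsection_orbit_sets G n x :
  map (fun B => xsection B x) (orbit_sets product_map G n) =
  [seq iter i g @^-1` (xsection G (iter i f x)) | i <- iota 0 n].
Proof.
rewrite /orbit_sets -map_comp; apply: eq_map => i /=.
by rewrite !xsectionE; apply/seteqP; split=> y;
  rewrite /preimage /= iter_product_map.
Qed.

Variable G : set (T1 * T2).
Hypotheses (mG : measurable G) (zG : zero_entropy lambda product_map G).

(* Along an orbit starting at [x], the fibres over the visits to [B] are close
   to [D], and thus contribute the entropy of as many preimages of [D]. *)
Let count_visits_le B D c e n x : measurable B -> measurable D ->
  (forall k, c <= entropy_increment nu g D k) ->
  (forall x, B x -> ent nu [:: D `+` xsection G x] <= e) ->
  (c - e) * (count (fun i => iter i f x \in B) (iota 0 n))%:R <=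
  ent nu (map (fun A => xsection A x) (orbit_sets product_map G n)).
Proof.
move=> mB mD hc he; rewrite xsection_orbit_sets.
set b := fun i => _.
have := suborbit_entropy_ge mg nug b 0 n mD hc.
have mi i E : measurable E -> measurable (iter i g @^-1` E).
  by move=> mE; exact: measurable_iter_preimage.
have mxs i : measurable (iter i g @^-1` xsection G (iter i f x)).
  by apply: mi; exact: measurable_xsection.
have h1 := @entropy_filter_le _ _ _ nu _
  (fun i => iter i g @^-1` xsection G (iter i f x)) b (iota 0 n) mxs.
have := @entropy_replace_map_le _ _ _ nu _ (fun i => iter i g @^-1` D)
  (fun i => iter i g @^-1` xsection G (iter i f x)) [seq i <- iota 0 n | b i] e
  (fun i => mi i _ mD) mxs.
rewrite size_filter => /(_ _) h2 h3.
rewrite mulrBl; suff /h2 : {in [seq i <- iota 0 n | b i], forall i,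
  ent nu [:: (iter i g @^-1` D) `+` (iter i g @^-1` xsection G (iter i f x))]
    <= e}.
  lra.
move=> i; rewrite mem_filter => /andP[/set_mem Bi _].
have mY := measurable_setY mD (measurable_xsection (iter i f x) mG).
have := entropy_shift mg nug [:: 0%N] i mY; rewrite /= addn0 => ->.
exact: he.
Qed.

Let count_visitsE B n x :
  (count (fun i => iter i f x \in B) (iota 0 n))%:R =
  \sum_(i <- iota 0 n) \1_(iter i f @^-1` B) x :> R.
Proof.
rewrite -sum1_count big_mkcond natr_sum; apply: eq_bigr => i _.
by rewrite indicE /preimage; case: ifPn => [/set_mem h|/negP h];
  [rewrite mem_set|rewrite memNset// => h'; apply: h; rewrite inE].
Qed.

Let measurable_count_visits B n : measurable B ->
  measurable_fun setT (fun x =>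
    (count (fun i => iter i f x \in B) (iota 0 n))%:R : R).
Proof.
move=> mB; under eq_fun do rewrite count_visitsE.
apply: measurable_sum => i; apply: measurable_indic.
exact: measurable_iter_preimage.
Qed.

(** Each time contributes [pr mu B] by invariance; this mean replaces any pointwise ergodic
    theorem. *)
Let int_count_visits B n : measurable B ->
  (\int[mu]_x (count (fun i => iter i f x \in B) (iota 0 n))%:R%:E =
   (n%:R * pr mu B)%:E)%E.
Proof.
move=> mB; have mi i := measurable_iter_preimage mf i mB.
under eq_integral do rewrite count_visitsE -sumEFin.
rewrite ge0_integral_sum//; last first.
  by move=> i; apply/measurable_EFinP; exact: measurable_indic.
rewrite (eq_bigr (fun=> (pr mu B)%:E)) => [|i _].
  by rewrite sumEFin big_const_seq count_predT size_iota iter_addr addr0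
    mulr_natl.
by rewrite integral_indic// setIT -pr_EFin//; exact: mu_iter_preimage.
Qed.

Let increment_le_of_visits B D c e : measurable B -> measurable D ->
  mu B != 0%E ->
  (forall k, c <= entropy_increment nu g D k) ->
  (forall x, B x -> ent nu [:: D `+` xsection G x] <= e) -> c <= e.
Proof.
move=> mB mD B0 hc he; rewrite leNgt; apply/negP => ce.
have p0 : 0 < pr mu B.
  by rewrite lt_def pr_ge0 andbT; apply: contra_neq B0 => h;
    rewrite pr_EFin// h.
have q0 : 0 < (c - e) * pr mu B by apply: mulr_gt0 => //; lra.
(* The visits force growth at rate [(c - e) * pr mu B]; half of it contradicts this strictly at the
   positive time [N.+1]. *)
have [N hN] := zG (e := (c - e) * pr mu B / 2) ltac:(lra).
have ms : all_measurable (orbit_sets product_map G N.+1).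
  apply: all_measurable_map => i; apply: measurable_iter_preimage => //.
  exact: measurable_product_map.
have := hN N.+1 (leqnSn N); apply/negP; rewrite -ltNge.
rewrite -lte_fin; apply: lt_le_trans (xsection_entropy_int mu nu ms).
apply: (@lt_le_trans _ _ ((c - e)%:E * (N.+1%:R * pr mu B)%:E)%E).
  by rewrite -EFinM lte_fin; have := mulr_gt0 q0 (ltr0Sn R N); lra.
have mc : measurable_fun setT (fun x =>
    (count (fun i => iter i f x \in B) (iota 0 N.+1))%:R%:E : \bar R).
  by apply/measurable_EFinP; exact: measurable_count_visits.
rewrite -int_count_visits// -ge0_integralZl//; last first.
- by rewrite lee_fin; lra.
apply: ge0_le_integral => //.
- by move=> x _; rewrite -EFinM lee_fin mulr_ge0//; lra.
- exact: measurable_funeM.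
- by apply/measurable_EFinP; exact: measurable_xsection_entropy.
- by move=> x _; rewrite -EFinM lee_fin; exact: (count_visits_le _ _ mB mD hc
  he).
Qed.

Lemma zero_entropy_ae_xsection :
  {ae mu, forall x, zero_entropy nu g (xsection G x)}.
Proof.
have [D mD hD] := xsection_approximation nu mG.
have [r hr] : exists r : nat -> R, forall m, 0 < r m /\
    forall x, 0 <= x < r m -> entropy_term x + entropy_term (1 - x) <=
      m.+1%:R^-1.
  have /choice[r hr] : forall m, exists s : R, 0 < s /\
      forall x, 0 <= x < s -> entropy_term x + entropy_term (1 - x) <=
        m.+1%:R^-1.
    by move=> m; have [|s s0 hs] := @binary_entropy_small R m.+1%:R^-1;
      last exists s.
  by exists r.
have mx k x : measurable (xsection G x `+` D k).
  by apply: measurable_setY => //; exact: measurable_xsection.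
pose B k m := [set x | pr nu (xsection G x `+` D k) < r m].
have mB k m : measurable (B k m).
  have mGD : measurable (G `+` (setT `*` D k)).
    by apply: measurable_setY => //; exact: measurableX.
  have := measurable_pr_xsection nu mGD.
  have xE x : xsection (G `+` (setT `*` D k)) x = xsection G x `+` D k.
    by rewrite !xsectionE; apply/seteqP; split=> y; rewrite /setY /=; tauto.
  under eq_fun do rewrite xE.
  move=> /(_ measurableT `]-oo, r m[%classic (measurable_itv _)).
  by rewrite setTI; congr measurable; apply/seteqP; split=> x;
    rewrite /= in_itv.
(* Exceptional points are those lying in some null [B k m]. Any other point belongs only to sets
   [B k m] of positive measure, to which the visit argument applies. *)
pose Z k m := if mu (B k m) == 0%E then B k m else set0.
have nZ : mu.-negligible (\bigcup_k \bigcup_m Z k m).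
  apply: negligible_bigcup => k; apply: negligible_bigcup => m.
  by rewrite /Z; case: eqP => [B0|_]; [exact/negligibleP|exact:
    negligible_set0].
apply: negligibleS nZ => x /=; apply: contra_notP => nZx e e0.
(* With [t] the inverse of [m.+1], the entropy of [D k] grows at rate at most [2 * (2 * t)], and
   replacing the fibre by [D k] costs a further [t], five in all. *)
have [m me] : exists m : nat, m.+1%:R^-1 <= e / 5.
  exists (Num.truncn (e / 5)^-1); rewrite -[leRHS]invrK lef_pV2 ?posrE
    ?invr_gt0//.
    by apply: ltW; apply: truncnS_gt.
  lra.
have [r0 hrm] := hr m; have [k hk] := hD x _ r0.
pose t : R := m.+1%:R^-1.
have t0 : 0 < t by rewrite invr_gt0.
have t20 : 0 < 2 * t by lra.
have ent_le y : B k m y -> ent nu [:: xsection G y `+` D k] <= t.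
  by move=> By; rewrite entropy_set1//; apply: hrm; rewrite pr_ge0.
(* If all increments were at least [2 * t], the visits to [B k m], whose fibres are within [t] of
   [D k], would give [2 * t <= t]. *)
have [j hj] : exists j, entropy_increment nu g (D k) j < 2 * t.
  apply: contrapT => h; suff : 2 * t <= t by lra.
  apply: (@increment_le_of_visits (B k m) (D k)) => //.
  - apply/negP => B0; apply: nZx; exists k => //; exists m => //.
    by rewrite /Z B0.
  - by move=> j; rewrite leNgt; apply/negP => hj; apply: h; exists j.
  - by move=> y /ent_le; rewrite setYC.
have [N hN] := orbit_entropy_eventually mg nug (mD k) t20 hj.
exists N => n /hN; have := orbit_entropy_replace_le mg nug n
  (measurable_xsection x mG) (mD k) (ent_le x hk).
have : t * n%:R <= e / 5 * n%:R by rewrite ler_wpM2r.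
by lra.
Qed.

End zero_entropy_sections.

(** * Inseparable sets *)

Lemma orbit_sets_preimage (T T' : Type) (f : T -> T) (f' : T' -> T')
    (phi : T' -> T) F n : (forall x, phi (f' x) = f (phi x)) ->
  orbit_sets f' (phi @^-1` F) n = map (preimage phi) (orbit_sets f F n).
Proof.
move=> phif; rewrite /orbit_sets -map_comp; apply: eq_map => i /=.
have phi_iter x : phi (iter i f' x) = iter i f (phi x).
  by elim: i => //= i IH; rewrite phif IH.
by apply/seteqP; split => x; rewrite /preimage /= phi_iter.
Qed.

Section factor_maps.
Context {R : realType} {d d'} {T : measurableType d} {T' : measurableType d'}.
Variables (P : probability T R) (P' : probability T' R).
Variables (f : T -> T) (f' : T' -> T') (phi : T' -> T).
Hypotheses (phiP : forall A, measurable A -> P' (phi @^-1` A) = P A).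
Hypotheses (phif : forall x, phi (f' x) = f (phi x)).
Hypothesis (mf : measurable_fun setT f).

Lemma orbit_entropy_factor F n : measurable F ->
  set_entropy (pr P') (orbit_sets f' (phi @^-1` F) n) =
  set_entropy (pr P) (orbit_sets f F n).
Proof.
move=> mF; rewrite (orbit_sets_preimage _ _ phif) /set_entropy
  -{1}(preimage_setT phi) cell_entropy_preimage.
have : all_measurable (orbit_sets f F n).
  by apply: all_measurable_map => i; exact: measurable_iter_preimage.
elim: (orbit_sets _ _ _) setT (@measurableT _ T) => [|E s IH] A mA /=.
  by rewrite /pr phiP.
by move=> [mE ms]; rewrite !IH//; [exact: measurableD|exact: measurableI].
Qed.

Lemma zero_entropy_factor F : measurable F ->
  zero_entropy P' f' (phi @^-1` F) <-> zero_entropy P f F.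
Proof.
move=> mF; split=> z e /z[N hN]; exists N => n /hN;
  by rewrite orbit_entropy_factor.
Qed.

End factor_maps.

(** Equivalently, the hull of [A] provided by [zero_entropy_hull] meets [B] in positive measure. *)
Definition inseparable d (T : measurableType d) (R : realType)
    (mu : probability T R) (f : T -> T) (A B : set T) : Prop :=
  forall F, measurable F -> zero_entropy mu f F ->
    mu (A `\` F) = 0%E -> mu (B `&` F) = 0%E -> False.

(** * Smallest covers of zero entropy *)

Section zero_entropy_hull.
Context {R : realType} {d} {T : measurableType d}.
Variables (mu : probability T R) (f : T -> T).
Hypotheses (mf : measurable_fun setT f) (muf : invariant_measure mu f).

Let covers (A F : set T) :=
  [/\ measurable F, zero_entropy mu f F & mu (A `\` F) = 0%E].

Let covers_bigcap A (F : nat -> set T) : measurable A ->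
  (forall n, covers A (F n)) ->
  nonincreasing_seq F -> covers A (\bigcap_n F n).
Proof.
move=> mA cF dF; have mF n : measurable (F n) by case: (cF n).
have mI : measurable (\bigcap_n F n) by exact: bigcapT_measurable.
have AI : mu (A `\` \bigcap_n F n) = 0%E.
  apply: measure_negligible; first exact: measurableD.
  rewrite setDE setC_bigcap setI_bigcupr; apply: negligible_bigcup => n.
  by rewrite -setDE; apply/negligibleP; [exact: measurableD|case: (cF n)].
split=> //; apply: zero_entropy_approx => // r r0.
have : mu \o F @ \oo --> (pr mu (\bigcap_n F n))%:E.
  rewrite -pr_EFin//; apply: nonincreasing_cvg_mu => //.
  by apply: le_lt_trans (probability_le1 mu (mF 0%N)) _; exact: ltry.
move=> /fine_cvgP[_] /cvgr_dist_lt /(_ r r0)[N _ /(_ N (leqnn N))] /= hN.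
exists (F N) => //; split; first by case: (cF N).
rewrite setYC /setY (_ : _ `\` F N = set0) ?setU0; last first.
  by rewrite setD_eq0 => x; exact.
have := pr_split mu (mF N) mI; rewrite setIidr; last by move=> x; exact.
by move: hN; rewrite distrC /pr /= => /(le_lt_trans (ler_norm _)); lra.
Qed.

(** Covers are closed under intersection and decreasing limits, so the infimum of their measures is
    attained. A cover [F] missing part of the minimizer [H] of positive measure would make the
    intersection of [H] and [F] a cover below the infimum. *)
Lemma zero_entropy_hull A : measurable A -> exists H : set T,
  [/\ measurable H, zero_entropy mu f H, mu (A `\` H) = 0%E &
    forall F, measurable F -> zero_entropy mu f F -> mu (A `\` F) = 0%E ->
      mu (H `\` F) = 0%E].
Proof.
move=> mA; pose S := [set pr mu F | F in covers A].
have covT : covers A setT.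
  by split=> //; [apply: zero_entropy_trivial => //; right;
    exact: prT|rewrite setDT measure0].
have covI F E : covers A F -> covers A E -> covers A (F `&` E).
  move=> [mF zF aF] [mE zE aE]; split; first exact: measurableI.
    exact: zero_entropyI.
  rewrite setDIr; apply/eqP; rewrite -measure_le0.
  apply: le_trans (measureU2 _ _ _) _; try exact: measurableD.
  by rewrite [X in (X + _)%E]aF [X in (_ + X)%E]aE adde0.
have Sinf : has_inf S.
  by split; [exists (pr mu setT), setT|exists 0 => _ [F _ <-]; exact: pr_ge0].
have /choice[F hF] : forall n, exists F, covers A F /\ pr mu F < inf S +
  n.+1%:R^-1.
  move=> n; have : inf S < inf S + n.+1%:R^-1 by rewrite ltrDl.
  by move=> /(inf_lt Sinf.1)[_ [F cF <-] hF]; exists F.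
pose E n := \big[setI/setT]_(i < n.+1) F i.
have cE n : covers A (E n).
  by rewrite /E; elim/big_ind : _ => // i _; case: (hF i).
have dE : nonincreasing_seq E.
  move=> i j ij; apply/subsetPset => x; rewrite /E -!bigcap_mkord => h k /= ki.
  by apply: h => /=; exact: leq_trans ki _.
have [mH zH aH] := covers_bigcap mA cE dE.
exists (\bigcap_n E n); split=> // G mG zG aG.
have mHG : measurable (\bigcap_n E n `\` G) by exact: measurableD.
rewrite pr_EFin//; congr EFin; apply/eqP; rewrite eq_le pr_ge0 andbT.
apply/ler_addgt0Pl => e e0; rewrite addr0.
have := near_infty_natSinv_lt (PosNum e0); case=> n _ /(_ n (leqnn n)) /= ne.
have cHG := covI _ _ (And3 mH zH aH) (And3 mG zG aG).
have h1 : inf S <= pr mu (\bigcap_n E n `&` G).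
  by apply: ge_inf; [exact: Sinf.2|exists (\bigcap_n E n `&` G)].
have [_ h2] := hF n.
have h3 : pr mu (\bigcap_n E n) <= pr mu (F n).
  apply: le_pr => //; first by case: (hF n) => -[].
  by move=> x /(_ n I); rewrite /E -bigcap_mkord => /(_ n); apply => /=.
have {}ne : n.+1%:R^-1 < e := ne.
have h4 := pr_split mu mH mG.
rewrite -(lerD2l (pr mu (\bigcap_n E n `&` G))) -h4.
apply: (le_trans h3); apply: (le_trans (ltW h2)).
by apply: lerD => //; exact: ltW.
Qed.

End zero_entropy_hull.

(** * Inseparability in products of two systems *)

Section inseparable_product.
Context {R : realType} {d1 d2 : measure_display}.
Context {T1 : measurableType d1} {T2 : measurableType d2}.
Variables (mu : probability T1 R) (nu : probability T2 R).
Variables (f : T1 -> T1) (g : T2 -> T2).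
Hypotheses (mf : measurable_fun setT f) (mg : measurable_fun setT g).
Hypotheses (muf : invariant_measure mu f) (nug : invariant_measure nu g).

Let lambda : probability (T1 * T2)%type R := (mu \x nu)%E.
Let lambda' : probability (T2 * T1)%type R := (nu \x mu)%E.

Lemma null_of_xsections A : measurable A ->
  {ae mu, forall x, nu (xsection A x) = 0%E} -> lambda A = 0%E.
Proof.
move=> mA h.
rewrite -[LHS]/(\int[mu]_x (nu \o xsection A) x)%E.
rewrite (_ : 0 = \int[mu]_x cst 0 x)%E; last by rewrite integral_cst// mul0e.
apply: ae_eq_integral => //; first exact: measurable_fun_xsection.
by apply: filterS h => x h _.
Qed.

(** The section statements are proved over the first factor; this flip transfers them to the
    second. *)
Lemma product_measure_swap A : measurable A ->
  lambda' (swap_pair @^-1` A) = lambda A.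
Proof.
move=> mA.
pose m : {mfun (T2 * T1)%type >-> (T1 * T2)%type} :=
  HB.pack (@swap_pair T2 T1) (isMeasurableFun.Build _ _ _ _ (@swap_pair T2 T1)
    (@measurable_swap _ _ T2 T1)).
apply/esym/(@product_measure_unique _ _ _ _ R mu nu (distribution lambda' m))
  => //.
move=> B C mB mC.
rewrite /= /distribution /pushforward (_ : _ @^-1` _ = C `*` B).
  by rewrite product_measure1E// muleC.
by apply/seteqP; split=> -[x y] /= [].
Qed.

Lemma ysection_negligible A : measurable A -> lambda A = 0%E ->
  {ae nu, forall y, mu (ysection A y) = 0%E}.
Proof.
move=> mA A0; have mA' : measurable (swap_pair @^-1` A).
  by rewrite -[X in measurable X]setTI; exact: measurable_swap.
have := @xsection_negligible _ _ _ _ _ nu mu _ mA'.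
rewrite -/lambda' product_measure_swap// => /(_ A0); apply: filterS => y.
by rewrite xsectionE ysectionE.
Qed.

Lemma zero_entropy_ae_ysection A : measurable A ->
  zero_entropy lambda (product_map f g) A ->
  {ae nu, forall y, zero_entropy mu f (ysection A y)}.
Proof.
move=> mA zA; have mA' : measurable (swap_pair @^-1` A).
  by rewrite -[X in measurable X]setTI; exact: measurable_swap.
have zA' : zero_entropy lambda' (product_map g f) (swap_pair @^-1` A).
  apply/(zero_entropy_factor (P := lambda) (f := product_map f g)) => //.
  - exact: product_measure_swap.
  - exact: measurable_product_map.
have := zero_entropy_ae_xsection mg mf nug muf mA' zA'.
by apply: filterS => y; rewrite xsectionE ysectionE.
Qed.

(* A set [G] of zero entropy containing [A1 x A2] contains [A1 x H], where [H]
   is the hull of [A2]; a fibre over a point of [H] meeting [B2] then separates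
   [A1] from [B1]. *)
Lemma inseparable_setX A1 B1 A2 B2 :
  measurable A1 -> measurable B1 -> measurable A2 -> measurable B2 ->
  inseparable mu f A1 B1 -> inseparable nu g A2 B2 ->
  inseparable lambda (product_map f g) (A1 `*` A2) (B1 `*` B2).
Proof.
move=> mA1 mB1 mA2 mB2 insep1 insep2 G mG zG AG BG.
have [H [mH zH AH Hmin]] := zero_entropy_hull mg nug mA2.
have mAG : measurable ((A1 `*` A2) `\` G) by apply: measurableD => //;
  exact: measurableX.
have mBG : measurable ((B1 `*` B2) `&` G) by apply: measurableI => //;
  exact: measurableX.
have mHG : measurable ((A1 `*` H) `\` G) by apply: measurableD => //;
  exact: measurableX.
have HG : lambda ((A1 `*` H) `\` G) = 0%E.
  apply: null_of_xsections => //.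
  have := xsection_negligible mAG AG.
  have := zero_entropy_ae_xsection mf mg muf nug mG zG.
  apply: filterS2 => x zx; rewrite !xsectionD.
  have [xA|xA] := boolP (x \in A1); last by rewrite !notin_xsectionX// !set0D
    measure0.
  rewrite !in_xsectionX//; apply: Hmin => //; exact: measurable_xsection.
(* Inseparability of [A2] and [B2] is tested on the hull itself. *)
have BH : nu (B2 `&` H) != 0%E by apply/negP => /eqP; exact: insep2 AH.
have n1 := ysection_negligible mHG HG.
have n2 := ysection_negligible mBG BG.
have n3 := zero_entropy_ae_ysection mG zG.
have : {ae nu, forall y, ~ (B2 `&` H) y}.
  move: n1 n2 n3; apply: filterS3 => y n1 n2 n3 [yB yH].
  apply: (insep1 (ysection G y)) => //; first exact: measurable_ysection.
    by move: n1; rewrite ysectionD in_ysectionX// inE.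
  by move: n2; rewrite ysectionI in_ysectionX// inE.
move=> h; move/eqP: BH; apply; apply: measure_negligible;
  first exact: measurableI.
by apply: negligibleS h => y /= hy; apply.
Qed.

End inseparable_product.

(** * Boxes in finite powers of a system *)

Section tuple_boxes.
Context {R : realType} {d} {T : measurableType d}.
Variables (mu : probability T R) (f : T -> T).
Hypotheses (mf : measurable_fun setT f) (muf : invariant_measure mu f).
Implicit Types A B : nat -> set T.

Definition tuple_map n (x : n.-tuple T) : n.-tuple T := [tuple of map f x].

(** The sides are indexed by all naturals, so that removing the first coordinate is the shift
    [fun i => A i.+1] in inductions on [n]. *)
Definition box A n : set (n.-tuple T) :=
  [set x | forall i : 'I_n, A i (tnth x i)].
Arguments box : clear implicits.

Lemma measurable_box A n : (forall i, measurable (A i)) -> measurable (box A n).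
Proof.
move=> mA.
have -> : box A n = \bigcap_(i in [set: 'I_n]) ((@tnth n T ^~ i) @^-1` A i).
  by apply/seteqP; split=> x h i; [move=> _; exact: h|exact: (h i I)].
apply: fin_bigcap_measurable; first exact: finite_finset.
by move=> i _; rewrite -[X in measurable X]setTI; exact: measurable_tnth.
Qed.

Lemma measurable_tuple_map n : measurable_fun setT (@tuple_map n).
Proof.
apply/measurable_fun_tnthP => i.
rewrite (_ : _ \o _ = f \o (@tnth n T ^~ i)).
  by apply: measurableT_comp => //; exact: measurable_tnth.
by apply/funext => x; rewrite /= tnth_map.
Qed.

Lemma pair_cons_map n (z : T * n.-tuple T) :
  pair_cons (product_map f (@tuple_map n) z) = tuple_map (pair_cons z).
Proof. by apply: val_inj. Qed.

Lemma preimage_pair_cons_box A n :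
  @pair_cons _ T n @^-1` box A n.+1 = A 0%N `*` box (fun i => A i.+1) n.
Proof.
apply/seteqP; split=> -[x t] /=.
  move=> h; split=> [|i]; first exact: (h ord0).
  by have := h (lift ord0 i); rewrite /= (tnthS x t).
move=> [/= Ax h] i; case: (unliftP ord0 i) => [j|] -> //.
by have := h j; rewrite /pair_cons (tnthS x t).
Qed.

Lemma measurable_preimage_pair_cons n (F : set (n.+1.-tuple T)) :
  measurable F -> measurable (@pair_cons _ T n @^-1` F).
Proof.
by move=> mF; rewrite -[X in measurable X]setTI; exact: measurable_pair_cons.
Qed.

Lemma tuple_product_invariant n :
  invariant_measure (tuple_product mu n) (@tuple_map n).
Proof.
elim: n => [|n IH] A mA.
  by congr (_ _); apply/seteqP; split=> x; rewrite /preimage /= (tuple0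
    (tuple_map x)) (tuple0 x).
have mA' := measurable_preimage_pair_cons mA.
have h := product_map_invariant mf (@measurable_tuple_map n) muf IH mA'.
apply: etrans h.
rewrite (_ : _ @^-1` (_ @^-1` A) = @pair_cons _ T n @^-1` (@tuple_map n.+1
  @^-1` A))//.
by apply/seteqP; split=> z; rewrite /preimage /= pair_cons_map.
Qed.

Lemma zero_entropy_pair_cons n F : measurable F ->
  zero_entropy (mu \x tuple_product mu n)%E (product_map f (@tuple_map n))
    (@pair_cons _ T n @^-1` F) <->
  zero_entropy (tuple_product mu n.+1) (@tuple_map n.+1) F.
Proof.
move=> mF; apply: zero_entropy_factor => //.
  by move=> x; rewrite pair_cons_map.
exact: measurable_tuple_map.
Qed.

Lemma inseparable_box A B n :
  (forall i, measurable (A i)) -> (forall i, measurable (B i)) ->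
  (forall i, inseparable mu f (A i) (B i)) ->
  inseparable (tuple_product mu n) (@tuple_map n) (box A n) (box B n).
Proof.
elim: n A B => [|n IH] A B mA mB insep F mF zF AF BF.
  (* For empty tuples both boxes are the whole space, so [F] and its complement would both be
     null. *)
  have boxT C : box C 0 = setT by apply/seteqP; split=> // x _ [].
  move: AF BF; rewrite !boxT setTI setTD => AF BF.
  have := pr_split (tuple_product mu 0) measurableT mF.
  rewrite setTI setTD prT /pr AF BF addr0 => /eqP; rewrite oner_eq0//.
have := inseparable_setX mf (@measurable_tuple_map n) muf
  (@tuple_product_invariant n)
  (mA 0%N) (mB 0%N) (@measurable_box (fun i => A i.+1) n (fun i => mA i.+1))
  (@measurable_box (fun i => B i.+1) n (fun i => mB i.+1)) (insep 0%N)
  (IH _ _ (fun i => mA i.+1) (fun i => mB i.+1) (fun i => insep i.+1)).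
move=> /(_ _ (measurable_preimage_pair_cons mF)); apply.
- exact/zero_entropy_pair_cons.
- by rewrite -preimage_pair_cons_box; exact: AF.
- by rewrite -preimage_pair_cons_box; exact: BF.
Qed.

Lemma zero_entropy_box F n : measurable F -> zero_entropy mu f F ->
  zero_entropy (tuple_product mu n) (@tuple_map n) (box (fun=> F) n).
Proof.
move=> mF zF; elim: n => [|n IH].
  apply: zero_entropy_trivial => //.
  - exact: measurable_tuple_map.
  - exact: tuple_product_invariant.
  - exact: measurable_box.
  - by right; rewrite (_ : box _ _ = setT) ?prT//; apply/seteqP;
    split=> // x _ [].
apply/zero_entropy_pair_cons; first exact: measurable_box.
have mb : measurable (box (fun=> F) n) by exact: measurable_box.
rewrite preimage_pair_cons_box.
(* Each cylinder is pulled back from a factor, where its entropy is known to be zero. *)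
rewrite (_ : _ `*` _ = (fst @^-1` F) `&` (snd @^-1` (box (fun=> F) n)))//.
have mt := @measurable_tuple_map n.
apply: zero_entropyI.
- exact: measurable_product_map.
- by rewrite -[X in measurable X]setTI; exact: measurable_fst.
- by rewrite -[X in measurable X]setTI; exact: measurable_snd.
- apply/(zero_entropy_factor (P := mu) (f := f)) => // A mA.
  rewrite (_ : fst @^-1` A = A `*` setT).
    by rewrite [LHS]product_measure1E// [X in (_ * X)%E](probability_setT
      (tuple_product mu n)) mule1.
  by apply/seteqP; split=> [z|z []].
- apply/(zero_entropy_factor (P := tuple_product mu n) (f := @tuple_map n)) =>
  // A mA.
  rewrite (_ : snd @^-1` A = setT `*` A).
    by rewrite [LHS]product_measure1E// [X in (X * _)%E](probability_setT mu)
      mul1e.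
  by apply/seteqP; split=> [z|z []].
Qed.

End tuple_boxes.

Arguments box {d T} A n.

(** * The space of averages of point masses *)

Section UPE_inseparable.
Context {d} {R : realType} {X : borelMetricType d R}.
Variables (mu : probability X R) (T : X -> X).
Hypotheses (mT : measurable_fun setT T) (muT : invariant_measure mu T).
Hypothesis upe : UPE mu T.

Lemma entropy_pair_zero_entropy (F : set X) (y y' : X) : measurable F ->
  y <> y' -> nbhs y F -> nbhs y' (~` F) -> ~ zero_entropy mu T F.
Proof.
move=> mF yy' Fy Fy'; have [_ /(_ F mF Fy Fy')] := upe yy'.
by rewrite dynamical_entropyE; exact: (dynamical_entropy_gt0P mT muT mF).1.
Qed.

(** A separating [F] does so only up to null sets. Changing it on a null set yields [F'], which
    separates genuine neighbourhoods of [y] and [y'] and still has zero entropy, against UPE. *)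
Let inseparable_neq (A B : set X) (y y' : X) : measurable A -> measurable B ->
  y <> y' ->
  nbhs y A -> nbhs y' B -> inseparable mu T A B.
Proof.
move=> mA mB yy' Ay By' F mF zF AF BF.
have [[U V] /= [Uy Vy'] [oU oV UV]] :
    exists2 UV : set X * set X, y \in UV.1 /\ y' \in UV.2 &
      [/\ open UV.1, open UV.2 & UV.1 `&` UV.2 = set0].
  have := @metric_hausdorff R X; rewrite open_hausdorff => /(_ y y')[|[U V] [?
    ?] [? ? /eqP]]; first exact/eqP.
  by exists (U, V).
move: Uy Vy'; rewrite !inE => Uy Vy'.
have mU : measurable (A `&` U) by apply: measurableI => //;
  exact: open_measurable_borel.
have mV : measurable (B `&` V) by apply: measurableI => //;
  exact: open_measurable_borel.
(* Disjointness of [U] and [V] keeps the added part from being removed again. *)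
pose F' := (F `|` (A `&` U)) `\` (B `&` V).
have mF' : measurable F' by apply: measurableD => //; exact: measurableU.
apply: (entropy_pair_zero_entropy mF' yy').
- apply: filterS2 Ay (open_nbhs_nbhs (conj oU Uy)) => z Az Uz.
  by split; [right|move=> [_ Vz]; have : set0 z by rewrite -UV].
- apply: filterS2 By' (open_nbhs_nbhs (conj oV Vy')) => z Bz Vz [_]; exact.
apply: zero_entropy_approx => // r r0; exists F => //; split=> //.
have mAF : measurable (A `\` F) by exact: measurableD.
have mBF : measurable (B `&` F) by exact: measurableI.
apply: le_lt_trans r0; apply: (@le_trans _ _ (pr mu ((A `\` F) `|` (B `&` F)))).
  apply: le_pr; [exact: measurable_setY|exact: measurableU|].
  move=> z; rewrite /F' /setY /=.
  by have [] := pselect (F z); have [] := pselect (B z); tauto.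
by apply: (le_trans (prU_le mu mAF mBF)); rewrite /pr AF BF addr0.
Qed.

(** The centres may coincide, as distinct averages can share coordinates. A separating [F] would
    then make the neighbourhood [A] meet [B] in a null set; with a second point available, the empty
    set would separate this null neighbourhood from the whole space. *)
Lemma UPE_inseparable (z z' : X) (A B : set X) (y y' : X) : z <> z' ->
  measurable A -> measurable B -> nbhs y A -> nbhs y' B ->
  inseparable mu T A B.
Proof.
move=> zz' mA mB Ay By'.
have [yy'|/eqP yy'] := eqVneq y y'; last exact: inseparable_neq Ay By'.
have [w yw] : exists w, y <> w.
  by have [yz|/eqP yz] := eqVneq y z; [exists z'; rewrite yz|exists z].
move=> F mF zF AF BF; rewrite -{}yy' in By'.
have AB0 : mu (A `&` B) = 0%E.
  apply/eqP; rewrite -measure_le0.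
  have mAF : measurable (A `\` F) by exact: measurableD.
  have mBF : measurable (B `&` F) by exact: measurableI.
  apply: (@le_trans _ _ (mu ((A `\` F) `|` (B `&` F)))).
    apply: le_measure; rewrite ?inE; [exact: measurableI|exact: measurableU|].
    by move=> v /=; have [] := pselect (F v); tauto.
  apply: (le_trans (measureU2 _ mAF mBF)).
  by rewrite [X in (X + _)%E]AF [X in (_ + X)%E]BF adde0.
have mAB : measurable (A `&` B) by exact: measurableI.
have := @inseparable_neq (A `&` B) setT y w mAB measurableT yw.
move=> /(_ (filterI Ay By') filterT set0 measurable0); apply.
- apply: zero_entropy_trivial => //; left; exact: pr0.
- by rewrite setD0.
- by rewrite setI0 measure0.
Qed.

End UPE_inseparable.

(** * Continuity and measurability of the averaging map *)

Section average_map_topology.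
Context {d} {R : realType} {X : borelMetricType d R}.

Lemma average_dist_le n (x y : n.+1.-tuple X) e : 0 < e ->
  (forall i, mdist (tnth x i) (tnth y i) < e) ->
  average_dist (average_map x) (average_map y) <= e.
Proof.
move=> e0 xy; apply: prohorov_dist_le; split=> // A mA.
rewrite /= /average; apply: (@le_trans _ _
  ((n.+1%:R^-1)%:E * \sum_(i < n.+1) \d_(tnth y i) (thickening A e))%E);
    last first.
  by rewrite leeDl// lee_fin ltW.
apply: lee_wpmul2l; first by rewrite lee_fin invr_ge0.
apply: lee_sum => i _; rewrite !diracE lee_fin ler_nat.
case: (boolP (tnth x i \in A)) => //; rewrite inE => Ax.
by rewrite mem_set//; exists (tnth x i).
Qed.

Lemma nbhs_average_map n (x : n.+1.-tuple X) (S : set (average_space n.+1)) :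
  nbhs (average_map x) S -> exists2 r : R, 0 < r &
    box (fun i => ball (nth point x i) r) n.+1 `<=` @average_map _ _ _ n @^-1`
      S.
Proof.
(* Halving restores the strict inequality, since [average_dist_le] yields only a weak one. *)
move=> /nbhs_ballP[s /= s0 hs]; exists (s / 2); first by rewrite divr_gt0.
move=> y hy; apply: hs; rewrite ballEmdist /=.
apply: (@le_lt_trans _ _ (s / 2)); last by lra.
apply: average_dist_le; first by lra.
by move=> i; have := hy i; rewrite ballEmdist /= (tnth_nth point x).
Qed.

(** Tuples carry the product sigma-algebra, so continuity alone does not suffice. Compactness gives
    a countable base, and the preimage of an open set is a countable union of boxes with sides in
    it. *)
Lemma measurable_average_map n : compact [set: X] ->
  measurable_fun setT (@average_map _ _ X n).
Proof.
move=> cX; apply: (measurability (@open (average_space n.+1)) erefl).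
move=> _ [V oV <-]; rewrite setTI.
have [B cB [Bo Bb]] := compact_second_countable cX.
have [b ob bB] : exists2 b : nat -> set X, forall i, open (b i) & B `<=` range
  b.
  have /countable_injP[f inj] := cB.
  pose b i := if pselect (exists2 U, B U & f U = i) is left h
    then s2val (cid2 h) else setT.
  exists b => [i|U BU].
    by rewrite /b; case: pselect => [h|_]; [case: cid2 => W /= BW _;
      exact: Bo|exact: openT].
  exists (f U) => //; rewrite /b; case: pselect => [h|[]]; last by exists U.
  by case: cid2 => W /= BW fWU; apply: inj; rewrite ?inE.
(* Finite lists of indices into the base form a countable type; boxes not contained in the preimage
   are discarded as empty. *)
pose D l := if `[< box (fun i => b (nth 0%N l i)) n.+1 `<=` @average_map _ _ X
  n @^-1` V >]
  then box (fun i => b (nth 0%N l i)) n.+1 else set0.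
suff -> : @average_map _ _ X n @^-1` V = \bigcup_l D l.
  apply: countable_bigcupT_measurable => [|l]; first exact: countableP.
  rewrite /D; case: ifP => // _; apply: measurable_box => i.
  exact: open_measurable_borel.
apply/seteqP; split=> [x Vx|x [l _]]; last first.
  by rewrite /D; case: asboolP => // h; exact: h.
have [r r0 hr] := nbhs_average_map (open_nbhs_nbhs (conj oV Vx)).
have /choice[k hk] : forall i : nat, exists k : nat,
    b k (nth point x i) /\ b k `<=` ball (nth point x i) r.
  move=> i; have := Bb (nth point x i) _ (nbhsx_ballx (nth point x i) r r0).
  move=> [U [BU Ux] Ur]; have [j _ bj] := bB U BU.
  by exists j; rewrite bj.
exists (mkseq k n.+1) => //; rewrite /D asboolT => [i|y hy].
  by rewrite nth_mkseq// (tnth_nth point); exact: (hk i).1.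
apply: hr => i; have := hy i; rewrite nth_mkseq//; exact: (hk i).2.
Qed.

End average_map_topology.

(** * Borel measurability of evaluation on a fixed Borel set *)

Section average_evaluation.
Context {d} {R : realType} {X : borelMetricType d R} (n : nat).

Local Notation Mn := (average_space (X := X) n.+1).

Let eval (A : set X) (nu : Mn) : \bar R := sval nu A.

(** Lower semicontinuity of the mass of an open set. An average has finitely many atoms, so those in
    [U] have balls of a common radius contained in [U], and a slightly shrunk [U] already carries
    all their mass. *)
Let open_eval_gt U (t : \bar R) : open U -> open [set nu | t < eval U nu]%E.
Proof.
move=> oU; rewrite openE => nu /=; have [x nux] := svalP nu.
have -> : nu = average_map x by apply: average_space_inj.
set m := eval U _ => tm.
have [r r0 hr] : exists2 r : R, 0 < r &
    forall i, tnth x i \in U -> ball (tnth x i) r `<=` U.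
  have /choice[s hs] : forall i : 'I_n.+1, exists s : R, 0 < s /\
      (tnth x i \in U -> ball (tnth x i) s `<=` U).
    move=> i; have [xU|xU] := boolP (tnth x i \in U); last by exists 1.
    have /nbhs_ballP[s s0 sU] : nbhs (tnth x i) U.
      by apply: open_nbhs_nbhs; split=> //; exact/set_mem.
    by exists s.
  exists (\big[Order.min/1]_i s i); first by apply: lt_bigmin => // i _;
    case: (hs i).
  move=> i xU y; rewrite ballEmdist /= => h; apply: (hs i).2 => //.
  by rewrite ballEmdist /=; apply: (lt_le_trans h); exact: bigmin_le.
have mfin : m \is a fin_num by apply: fin_num_measure;
  exact: open_measurable_borel.
have [q q0 tq] : exists2 q : R, 0 < q & (t < m - q%:E)%E.
  move: tm; rewrite -(fineK mfin); move: t => [t| |] //; last first.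
    by move=> _; exists 1 => //; rewrite -EFinB ltNyr.
  rewrite lte_fin => tm; exists ((fine m - t) / 2);
    first by rewrite divr_gt0// subr_gt0.
  by rewrite -EFinB lte_fin; lra.
apply/nbhs_ballP; exists (Num.min q r); first by rewrite /= lt_min q0.
move=> nu'; rewrite ballEmdist /= => h.
have /prohorov_dist_lt[p0 hp] := h.
set p := Num.min q r in p0 hp *.
have [pq pr'] : p <= q /\ p <= r by rewrite /p !ge_min !lexx orbT.
(* The points at distance at least [p] from the complement of [U]: they include the atoms in [U],
   and the [p]-thickening of [V] stays in [U]. *)
pose V := ~` thickening (~` U) p.
have mV : measurable V by apply: measurableC; exact: measurable_thickening.
have VU : thickening V p `<=` U.
  move=> z [y Vy yz]; apply: contrapT => Uz; apply: Vy; exists z => //.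
  by rewrite metric_sym.
have mVE : (m <= sval (average_map x) V)%E.
  rewrite /m /eval /= /average; apply: lee_wpmul2l;
    first by rewrite lee_fin invr_ge0.
  apply: lee_sum => i _; rewrite !diracE lee_fin ler_nat.
  have [xU|//] := boolP (tnth x i \in U).
  rewrite mem_set// => -[z Uz zx]; apply: Uz; apply: (hr i xU).
  by rewrite ballEmdist /= metric_sym; exact: lt_le_trans pr'.
have mU := open_measurable_borel oU.
have := le_trans mVE (hp V mV); rewrite -leeBlDr// => mnu'.
apply: (lt_le_trans tq); apply: (@le_trans _ _ (m - p%:E)%E).
  by apply: leeB => //; rewrite lee_fin.
apply: (le_trans mnu'); apply: le_measure; rewrite ?inE//.
exact: measurable_thickening.
Qed.

(** The sets with measurable evaluation form a lambda-system containing the open sets, which are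
    stable under intersection. *)
Lemma measurable_average_evaluation (A : set X) : measurable A ->
  measurable_fun setT (fun nu : Mn => sval nu A).
Proof.
pose H := [set A : set X | measurable A /\ measurable_fun setT (eval A)].
suff : measurable `<=` H by move=> + mA => /(_ A mA)[].
rewrite measurable_borelE; apply: lambda_system_subset => //.
- by move=> U V; exact: openI.
- split => //.
  + by split => //; apply: (eq_measurable_fun (cst 1%E)) => // nu _;
    rewrite /eval probability_setT.
  + move=> U V VU [mU hU] [mV hV]; split; first exact: measurableD.
    rewrite (_ : eval _ = (eval U \- eval V)%E); first exact: emeasurable_funB.
    apply/funext => nu; rewrite /eval measureD//;
      last by rewrite -ge0_fin_numE// fin_num_measure.
    by rewrite setIidr.
  + move=> F ndF hF; have mF : measurable (\bigcup_i F i).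
      by apply: bigcupT_measurable => i; case: (hF i).
    split => //; apply: (emeasurable_fun_cvg (fun i => eval (F i))) => [i|nu _].
      by case: (hF i).
    by apply: nondecreasing_cvg_mu => // i; case: (hF i).
- move=> U oU; split; first exact: open_measurable_borel.
  apply: (measurability _ (ErealGenOInfty.measurableE R)).
  move=> _ [_ [t ->] <-]; rewrite setTI.
  apply: open_measurable_borel; rewrite (_ : _ @^-1` _ = [set nu | t%:E < eval
    U nu]%E).
    exact: open_eval_gt.
  by apply/seteqP; split=> nu; rewrite /= in_itv /= andbT.
Qed.

End average_evaluation.

(** * Transfer of uniformly positive entropy between the two systems *)

Section average_system.
Context {d} {R : realType} {X : borelMetricType d R}.
Variables (T : X -> X) (hT : homeomorphism T) (mu : probability X R).
Hypotheses (muT : invariant_measure mu T) (cX : compact [set: X]).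

Let mT := homeomorphism_measurable hT.

Lemma average_map_equivariant n (x : n.+1.-tuple X) :
  average_map (tuple_map T x) = induced_map hT n.+1 (average_map x).
Proof.
apply: average_space_inj => A /=; rewrite /pushforward /average.
congr (_ * _)%E; apply: eq_bigr => i _; rewrite tnth_map !diracE.
by congr (_ %:R)%:E; congr nat_of_bool; apply/idP/idP; rewrite !inE.
Qed.

(** The entropy of [S] under the pushforward is that of its preimage, cell by cell, so all entropy
    arguments can take place on tuples. *)
Lemma average_dynamical_entropy_gt0P n (S : set (average_space n.+1)) :
  measurable (@average_map _ _ X n @^-1` S) ->
  0 < dynamical_entropy (average_measure mu n) (induced_map hT n.+1)
        (two_set_partition S) <->
  ~ zero_entropy (tuple_product mu n.+1) (@tuple_map _ _ T n.+1)
      (@average_map _ _ X n @^-1` S).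
Proof.
move=> mS; rewrite dynamical_entropyE.
have <- := @dynamical_entropy_gt0P _ _ _ (tuple_product mu n.+1) _
  (@measurable_tuple_map _ _ _ mT n.+1) (@tuple_product_invariant _ _ _ _ _ mT
    muT n.+1) _ mS.
suff h k : set_entropy (fine \o average_measure mu n)
      (orbit_sets (induced_map hT n.+1) S k) =
    set_entropy (pr (tuple_product mu n.+1))
      (orbit_sets (@tuple_map _ _ T n.+1) (@average_map _ _ X n @^-1` S) k).
  by under eq_fun do rewrite h.
rewrite (orbit_sets_preimage _ _ (@average_map_equivariant n)).
by rewrite /set_entropy -(preimage_setT (@average_map _ _ X n))
  cell_entropy_preimage.
Qed.

Lemma UPE_average n : UPE mu T ->
  UPE (average_measure mu n) (induced_map hT n.+1).
Proof.
move=> upe a b ab; split=> // S mS aS bS.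
have mavg := @measurable_average_map _ _ _ n cX.
have mS' : measurable (@average_map _ _ X n @^-1` S).
  by rewrite -[X in measurable X]setTI; exact: mavg.
apply/average_dynamical_entropy_gt0P => // zS.
have [x ax] := svalP a; have [y by_] := svalP b.
have aE : a = average_map x by apply: average_space_inj.
have bE : b = average_map y by apply: average_space_inj.
(* One differing coordinate provides the two distinct points that [UPE_inseparable] requires for
   every coordinate, including those where the centres agree. *)
have [i xy] : exists i, tnth x i <> tnth y i.
  apply/existsNP => xy; apply: ab; rewrite aE bE; congr average_map.
  exact: eq_from_tnth.
rewrite aE in aS; rewrite bE in bS.
have [r r0 hr] := nbhs_average_map aS.
have [s s0 hs] := nbhs_average_map bS.
have mb z (e : R) : measurable (ball z e : set X).
  rewrite (_ : ball z e = thickening [set z] e);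
    first exact: measurable_thickening.
  by rewrite ballEmdist; apply/seteqP; split=> [w zw|w [_ -> zw]//]; exists z.
apply: (@inseparable_box _ _ _ _ _ mT muT (fun i => ball (nth point x i) r)
  (fun i => ball (nth point y i) s) n.+1 _ _ _ _ mS' zS).
- by move=> j; exact: mb.
- by move=> j; exact: mb.
- move=> j; apply: (UPE_inseparable mT muT upe xy);
    [exact: mb|exact: mb|exact: nbhsx_ballx|exact: nbhsx_ballx].
- by rewrite (_ : _ `\` _ = set0) ?measure0// setD_eq0.
- rewrite (_ : _ `&` _ = set0) ?measure0// -subset0 => z [/hs h1 h2].
  exact: h1 h2.
Qed.

Lemma average_ge n (x : n.+1.-tuple X) (B : set X) i : B (tnth x i) ->
  ((n.+1%:R^-1)%:E <= average x B)%E.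
Proof.
move=> Bi; rewrite -[leLHS]mule1 /average lee_wpmul2l ?lee_fin ?invr_ge0//.
by rewrite (bigD1 i)//= diracE mem_set// leeDl// sume_ge0//.
Qed.

Lemma average_eq0 n (x : n.+1.-tuple X) (B : set X) :
  (forall i, ~ B (tnth x i)) -> average x B = 0%E.
Proof.
move=> h; rewrite /average big1 ?mule0// => i _.
by rewrite diracE memNset.
Qed.

Lemma average_nseq n z (B : set X) : B z ->
  average (nseq_tuple n.+1 z) B = 1%E.
Proof.
move=> Bz; rewrite /average (eq_bigr (fun=> 1%:E)) => [|i _]; last first.
  by rewrite (tnth_nth z) nth_nseq ltn_ord diracE mem_set.
by rewrite sumEFin sumr_const card_ord -EFinM mulVf// pnatr_eq0.
Qed.

(** The Prohorov inequality is tested on the singleton of [z], whose thickening lies in [U] once the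
    radius is small. *)
Lemma nbhs_average_nseq n z (U : set X) (e : R) : measurable U -> 0 < e ->
  nbhs z U -> nbhs (average_map (nseq_tuple n.+1 z))
    [set nu : average_space n.+1 | 1 <= pr (sval nu) U + e].
Proof.
move=> mU e0 /nbhs_ballP[r /= r0 rU].
apply/nbhs_ballP; exists (Num.min e r); first by rewrite /= lt_min e0.
move=> nu; rewrite ballEmdist /= => /prohorov_dist_lt[p0 hp].
set p := Num.min e r in p0 hp.
have [pe pr'] : p <= e /\ p <= r by rewrite /p !ge_min !lexx orbT.
have mz : measurable [set z].
  apply: closed_measurable_borel; apply: accessible_closed_set1.
  exact: hausdorff_accessible (@metric_hausdorff R X).
have := hp _ mz; rewrite /= average_nseq// pr_EFin;
  last exact: measurable_thickening.
rewrite -EFinD lee_fin => /le_trans; apply; apply: lerD => //.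
apply: le_pr => //; first exact: measurable_thickening.
move=> w [_ -> zw]; apply: rU; rewrite ballEmdist /=; exact: lt_le_trans pr'.
Qed.

(** A set [F] of zero entropy violating UPE lifts to the set [Q] of averages charging only [F],
    which separates the point masses at [y] and [y']. *)
Lemma UPE_of_average n : UPE (average_measure mu n) (induced_map hT n.+1) ->
  UPE mu T.
Proof.
move=> upe y y' yy'; split=> // F mF Fy Fy'.
rewrite dynamical_entropyE; apply/(dynamical_entropy_gt0P mT muT mF) => zF.
have mFC := measurableC mF.
pose a (z : X) : average_space n.+1 := average_map (nseq_tuple n.+1 z).
pose Q := [set nu : average_space n.+1 | sval nu (~` F) = 0%E].
have n0 : 0 < n.+1%:R^-1 :> R by rewrite invr_gt0.
have QE : @average_map _ _ X n @^-1` Q = box (fun=> F) n.+1.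
  apply/seteqP; split=> x; rewrite /Q /=.
    move=> x0 i; apply: contrapT => Fi; have := @average_ge n x (~` F) i Fi.
    by rewrite x0 lee_fin leNgt n0.
  by move=> xF; apply: average_eq0 => i; apply; exact: xF.
have mQ : measurable Q.
  have := @measurable_average_evaluation _ _ X n _ mFC.
  by move=> /(_ measurableT [set 0%E] (emeasurable_set1 _)); rewrite setTI.
have ayy' : a y <> a y'.
  move=> /(congr1 (fun nu : average_space n.+1 => sval nu (~` F))) /=.
  rewrite (average_nseq n (nbhs_singleton Fy')) average_eq0.
    by move=> /esym/eqP; rewrite onee_eq0.
  move=> i; rewrite (tnth_nth y) nth_nseq ltn_ord; apply.
  exact: nbhs_singleton Fy.
have [_ /(_ Q mQ)] := upe _ _ ayy'.
(* Masses are multiples of the inverse of [n.+1], so charging the complement of [F] by at most half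
   of that unit means not charging it at all. *)
have h1 : nbhs (a y) Q.
  have e0 : 0 < n.+1%:R^-1 / 2 :> R by rewrite divr_gt0.
  apply: filterS (nbhs_average_nseq n mF e0 Fy) => nu /= hnu.
  have [x xnu] := svalP nu; rewrite /Q /= xnu; apply: average_eq0 => i Fi.
  have := average_ge Fi; rewrite -xnu pr_EFin// lee_fin prC//.
  by move: (n.+1%:R^-1) n0 hnu => t; lra.
(* Nearby averages give the complement of [F] mass at least one half, hence lie outside [Q]. *)
have h2 : nbhs (a y') (~` Q).
  have e0 : 0 < 2^-1 :> R by lra.
  apply: filterS (nbhs_average_nseq n mFC e0 Fy') => nu /= hnu nu0.
  by move: hnu; rewrite /pr nu0 /=; lra.
move=> /(_ h1 h2) /average_dynamical_entropy_gt0P; rewrite QE; apply.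
- exact: measurable_box.
- exact: zero_entropy_box.
Qed.

End average_system.

Theorem theorem3 (d : measure_display) (R : realType) (X : borelMetricType d R)
    (T : X -> X) (mu : probability X R)
    (cX : compact [set: X]) (hT : homeomorphism T)
    (mu_invariant : invariant_measure mu T) (mu_ergodic : ergodic mu T) :
  [<-> UPE mu T;
       exists n : nat, UPE (average_measure mu n) (induced_map hT n.+1);
       forall n : nat, UPE (average_measure mu n) (induced_map hT n.+1)].
Proof.
(* The passage from one number of point masses to all others goes through [X] itself; index 0
   corresponds to a single point mass. *)
tfae=> [upe|[n /UPE_of_average upe] k|upe].
- by exists 0%N; exact: UPE_average.
- by apply: UPE_average => //; exact: upe.
- exact: UPE_of_average (upe 0%N).
Qed.
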